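(* Let $T>0$, let $f:[0,T]\times\mathcal{I}\times\mathbb{R}^n\to\mathcal{I}$ be Hausdorff continuous, let $x_0\in\mathcal{I}$, and consider the control system $\frac{dx}{dt}(t)=f(t,x(t),u(t))$, $t\in[0,T]$, $x(0)=x_0$, in the sense of (ii)-differentiability. Consider the problem (IOCP): minimize $F(u):=\int_0^TL(t,x(t),u(t))\,dt$ subject to $u\in U_{ad}$, where $L:[0,T]\times\mathcal{I}\times\mathbb{R}^n\to\mathcal{I}$ and $x$ is the solution of the system corresponding to $u$; it is assumed that for each $u\in U_{ad}$ and corresponding $x$, $L(\cdot,x(\cdot),u(\cdot))$ is measurable and integrably bounded on $[0,T]$. Assume that (A1) $U_{ad}$ is the set of all continuous functions from $[0,T]$ to $\mathbb{R}^n$ with norm $\|u\|_{U_{ad}}=\max_{t\in[0,T]}\|u(t)\|_{\mathbb{R}^n}$; (A2) there exist $k_1>0$ and $k_2>0$ such that for all $t\in[0,T]$, $x_1,x_2\in\mathcal{I}$, $u_1,u_2\in\mathbb{R}^n$, $d_H(f(t,x_1,u_1),f(t,x_2,u_2))\le k_1d_H(x_1,x_2)+k_2\|u_1-u_2\|_{\mathbb{R}^n}$; (A3) $L$ is $\preccurlyeq$-lower semicontinuous on $[0,T]\times\mathcal{I}\times\mathbb{R}^n$; (A4) $[0,0]\preccurlyeq L(t,\zeta,\eta)$ for all $(t,\zeta,\eta)\in[0,T]\times\mathcal{I}\times\mathbb{R}^n$. Suppose moreover that for each $u\in U_{ad}$ and $t\in[0,T]$ the Hukuhara difference $\chi\ominus_H\int_0^t-f(s,y(s),u(s))\,ds$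 exists for all $y\in C([0,T],\mathcal{I})$ and all $\chi\in\mathcal{I}$. Then for every given $\varepsilon>0$ there exists an $\varepsilon$-minimal solution of (IOCP), i.e., a $u_0\in U_{ad}$ such that for all $u\in U_{ad}$, $F(u)+[\varepsilon\|u-u_0\|_{U_{ad}},\varepsilon\|u-u_0\|_{U_{ad}}]\not\prec F(u_0)$.
   Context: $\mathcal{I}=\{[a,b]:a\le b,\ a,b\in\mathbb{R}\}$ is the set of closed bounded real intervals, with $[\underline{a},\overline{a}]+[\underline{b},\overline{b}]=[\underline{a}+\underline{b},\overline{a}+\overline{b}]$, $\lambda[\underline a,\overline a]=[\lambda\underline a,\lambda\overline a]$ if $\lambda\ge0$ and $[\lambda\overline a,\lambda\underline a]$ if $\lambda<0$, $-A=(-1)A$, and Hausdorff distance $d_H([\underline{a},\overline{a}],[\underline{b},\overline{b}])=\max\{|\underline{a}-\underline{b}|,|\overline{a}-\overline{b}|\}$. Limits of intervals and Hausdorff continuity are with respect to $d_H$. $C([0,T],\mathcal{I})$ is the set of Hausdorff continuous functions $[0,T]\to\mathcal{I}$. $[\underline{a},\overline{a}]\preccurlyeq[\underline{b},\overline{b}]$ means $\underline{a}\le\underline{b}$, $\overline{a}\le\overline{b}$; $[\underline{a},\overline{a}]\prec[\underline{b},\overline{b}]$ means $\underline{a}<\underline{b}$, $\overline{a}<\overline{b}$; $\not\prec$ is its negation. A function $g:Y\to\mathcal{I}$ on a metric space $Y$ is $\preccurlyeq$-lower semicontinuous if $\{y\in Y:g(y)\preccurlyeq A\}$ is closed for every $A\in\mathcal{I}$;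 $\mathcal{I}$ carries $d_H$ and products carry the product metric. The Hukuhara difference $A\ominus_HB$ is the interval $C\in\mathcal{I}$ with $A=B+C$, if it exists. An interval-valued function $x$ of a real variable is (ii)-differentiable at $t_0$ with derivative $\frac{dx}{dt}(t_0)\in\mathcal{I}$ if for all $h<0$ sufficiently near $0$ the differences $x(t_0+h)\ominus_Hx(t_0)$ and $x(t_0)\ominus_Hx(t_0-h)$ exist and $\frac{dx}{dt}(t_0)=\lim_{h\to0_-}\frac{x(t_0+h)\ominus_Hx(t_0)}{h}=\lim_{h\to0_-}\frac{x(t_0)\ominus_Hx(t_0-h)}{h}$; it is (ii)-differentiable on $[0,T]$ if this holds at every point (at an endpoint, only the one-sided difference that makes sense is required). A solution of the system is a (ii)-differentiable $x:[0,T]\to\mathcal{I}$ satisfying it. Under (A1), (A2) and the Hukuhara difference hypothesis of the claim, each $u\in U_{ad}$ has a unique such solution, given by $x(t)=x_0\ominus_H\int_0^t-f(s,x(s),u(s))\,ds$. For $g:[a,b]\to\mathcal{I}$, the Aumann integral is $\int_a^bg(t)\,dt=\{\int_a^b\gamma(t)\,dt:\gamma:[a,b]\to\mathbb{R}\text{ Lebesgue integrable},\ \gamma(t)\in g(t)\ \forall t\}$. $g$ is measurable if $\{t:g(t)\cap A\ne\emptyset\}$ is Lebesgue measurable for every closed $A\subset\mathbb{R}$, and integrably bounded if there is a Lebesgue integrable $k:[a,b]\to[0,+\infty)$ with $|y|\le k(t)$ for all $t$ and $y\in g(t)$; if both hold and $g=[\underline{g},\overline{g}]$ then $\int_a^bg\,dt=[\int_a^b\underline{g}\,dt,\int_a^b\overline{g}\,dt]$.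 *)

(* Defs.v *)
From HB Require Import structures.
From mathcomp Require Import all_boot all_order all_algebra.
From mathcomp Require Import all_classical all_reals all_analysis.

Set Implicit Arguments.
Unset Strict Implicit.
Unset Printing Implicit Defensive.

Import Order.TTheory GRing.Theory Num.Theory.
Import numFieldNormedType.Exports.

Local Open Scope classical_set_scope.
Local Open Scope ring_scope.

Record cbitv (R : realType) := CBItv {
  ends : R * R ;
  ends_le : ends.1 <= ends.2
}.

HB.instance Definition _ (R : realType) := [isSub for @ends R].
HB.instance Definition _ (R : realType) := [Choice of cbitv R by <:].

Section interval_operations.
Context {R : realType}.
Implicit Types (A B : cbitv R) (r : R).

Definition lo A : R := (ends A).1.
Definition hi A : R := (ends A).2.
Definition points A : set R := [set r | lo A <= r <= hi A].

Definition isingle r : cbitv R := @CBItv R (r, r) (lexx r).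

Fact iadd_subproof A B : lo A + lo B <= hi A + hi B.
Proof. exact: lerD (ends_le A) (ends_le B). Qed.

Definition iadd A B : cbitv R :=
  @CBItv R (lo A + lo B, hi A + hi B) (iadd_subproof A B).

Definition scale_ends r A : R * R :=
  if 0 <= r then (r * lo A, r * hi A) else (r * hi A, r * lo A).

Fact iscale_subproof r A : (scale_ends r A).1 <= (scale_ends r A).2.
Proof.
rewrite /scale_ends; case: ifPn => [r0|] /=.
  exact: ler_wpM2l r0 _ _ (ends_le A).
by rewrite -ltNge => /ltW r0; exact: ler_wnM2l r0 _ _ (ends_le A).
Qed.

Definition iscale r A : cbitv R := CBItv (iscale_subproof r A).

Definition iopp A : cbitv R := iscale (-1) A.

Definition ile A B : bool := (lo A <= lo B) && (hi A <= hi B).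
Definition ilt A B : bool := (lo A < lo B) && (hi A < hi B).

Definition dH A B : R := Num.max `|lo A - lo B| `|hi A - hi B|.

Fact dHxx A : dH A A = 0.
Proof. by rewrite /dH !subrr normr0 maxxx. Qed.

Fact dH_eq0 A B : dH A B = 0 -> A = B.
Proof.
move=> d0.
have : dH A B <= 0 by rewrite d0.
rewrite /dH ge_max !normr_le0 !subr_eq0 => /andP[/eqP l /eqP h].
by apply: val_inj => /=; rewrite [LHS]surjective_pairing [RHS]surjective_pairing
  -/(lo A) -/(hi A) l h.
Qed.

Fact dHC A B : dH A B = dH B A.
Proof. by rewrite /dH distrC [X in Num.max _ X]distrC. Qed.

Fact dH_triangle B A C : dH A C <= dH A B + dH B C.
Proof.
rewrite {1}/dH ge_max; apply/andP; split.
  by apply: le_trans (ler_distD (lo B) _ _) _; apply: lerD; rewrite le_max lexx.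
apply: le_trans (ler_distD (hi B) _ _) _.
by apply: lerD; rewrite le_max lexx orbT.
Qed.

End interval_operations.

HB.instance Definition _ (R : realType) := isPointed.Build (cbitv R) (isingle 0).

(* From here on, limits, continuity and closed sets involving [cbitv R] are
   those of the Hausdorff metric. *)
HB.instance Definition _ (R : realType) :=
  isMetric.Build R (cbitv R) (@dHxx R) (@dH_eq0 R) (@dHC R) (@dH_triangle R).

Section hukuhara.
Context {R : realType}.
Implicit Types (A B C D : cbitv R) (a b t : R) (x : R -> cbitv R).

Definition hdiff_exists A B : Prop := exists C, A = iadd B C.

(* Such a [C] is unique; the value is the junk interval [0,0] if none exists. *)
Definition hdiff A B : cbitv R := get [set C | A = iadd B C].

(* [D] is the (ii)-derivative at [t] of [x], seen as a function on [a, b] only: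
   for h < 0, the point t + h requires a < t and the point t - h requires
   t < b. *)
Definition is_ii_derive a b x t D : Prop :=
  (a < t ->
     (\forall h \near (0 : R)^'-, hdiff_exists (x (t + h)) (x t)) /\
     iscale h^-1 (hdiff (x (t + h)) (x t)) @[h --> (0 : R)^'-] --> D) /\
  (t < b ->
     (\forall h \near (0 : R)^'-, hdiff_exists (x t) (x (t - h))) /\
     iscale h^-1 (hdiff (x t) (x (t - h))) @[h --> (0 : R)^'-] --> D).

End hukuhara.

Section aumann.
Context {R : realType}.
Implicit Types (a b : R) (g : R -> cbitv R).

(* The plain [lebesgue_measure] lives on the Borel sets; Lebesgue measurability
   and integrability refer to its completion. *)
Local Notation mu := (@completed_lebesgue_measure R).

Definition aumann_set a b g : set R :=
  [set r | exists gamma : R -> R,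
     [/\ mu.-integrable `[a, b] (EFin \o gamma),
         forall t, t \in `[a, b] -> points (g t) (gamma t) &
         r = \int[mu]_(t in `[a, b]) gamma t]].

(* The interval whose set of points is the Aumann integral; it is the junk
   interval [0,0] if the Aumann integral is not a closed bounded interval, in
   particular if [g] has no integrable selection. *)
Definition aumann a b g : cbitv R := get [set A | points A = aumann_set a b g].

(* The Caratheodory sets of the outer measure induced by interval length: the
   domain of [mu]. *)
Definition imeasurable a b g : Prop :=
  forall A : set R, closed A ->
    (wlength idfun)^*%mu.-cara.-measurable
      [set t | t \in `[a, b] /\ points (g t) `&` A !=set0].

Definition integrably_bounded a b g : Prop :=
  exists k : R -> R,
    [/\ mu.-integrable `[a, b] (EFin \o k),
        forall t, t \in `[a, b] -> 0 <= k t &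
        forall t, t \in `[a, b] -> forall y, points (g t) y -> `|y| <= k t].

End aumann.

Section control.
Context {R : realType} {n : nat}.

(* The library's norm on ['rV_n] is the sup norm. It has the same topology. *)
Definition enorm (v : 'rV[R]_n) : R := Num.sqrt (\sum_(i < n) v 0 i ^+ 2).

(* Functions on [0, T] are represented by functions on R whose values outside
   [0, T] are irrelevant. *)
Definition Uad (T : R) : set (R -> 'rV[R]_n) :=
  [set u | {within `[0, T], continuous u}].

(* For 0 < T and [u] in [Uad T] this supremum is a maximum. *)
Definition Unorm (T : R) (u : R -> 'rV[R]_n) : R :=
  sup [set enorm (u t) | t in `[0, T]].

Definition dom (T : R) : set (R * cbitv R * 'rV[R]_n) :=
  [set p | p.1.1 \in `[0, T]].

Definition ile_lsc {Y : topologicalType} (D : set Y) (g : Y -> cbitv R) : Prop :=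
  forall A : cbitv R, closed ([set y | D y /\ ile (g y) A] : set (subspace D)).

Definition is_solution (T : R) (f : R * cbitv R * 'rV[R]_n -> cbitv R)
    (x0 : cbitv R) (u : R -> 'rV[R]_n) (x : R -> cbitv R) : Prop :=
  x 0 = x0 /\
  forall t, t \in `[0, T] -> is_ii_derive 0 T x t (f (t, x t, u t)).

(* Under the hypotheses of the theorem a solution exists and is unique on
   [0, T], so that the choice made outside [0, T] is immaterial. *)
Definition trajectory (T : R) (f : R * cbitv R * 'rV[R]_n -> cbitv R)
    (x0 : cbitv R) (u : R -> 'rV[R]_n) : R -> cbitv R :=
  get [set x | is_solution T f x0 u x].

Definition cost (T : R) (f : R * cbitv R * 'rV[R]_n -> cbitv R) (x0 : cbitv R)
    (L : R * cbitv R * 'rV[R]_n -> cbitv R) (u : R -> 'rV[R]_n) : cbitv R :=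
  aumann 0 T (fun t => L (t, trajectory T f x0 u t, u t)).

End control.

(* Main.v *)
Require Import Defs.
From HB Require Import structures.
From mathcomp Require Import all_boot all_order all_algebra.
From mathcomp Require Import all_classical all_reals all_analysis.
From mathcomp Require Import measurable_realfun ring lra.
Import Order.TTheory GRing.Theory Num.Theory.
Import numFieldNormedType.Exports.
Local Open Scope classical_set_scope.
Local Open Scope ring_scope.

(** The relation [ilt] asks for a strict inequality at both endpoints, so it is
    refuted as soon as the upper endpoints are in the opposite order. Hence a
    control [u0] is an eps-minimal solution as soon as
    [hi F(u0) <= hi F(u) + eps * d u0 u] for all [u], for a distance [d] bounded
    by the norm of the difference: this is what Ekeland's variational principle
    ([ekeland]) gives for the real functional [hi F] on the complete space
    C([0,T], R^n), provided that [hi F] is nonnegative and lower semicontinuous.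
    Here [d] is the uniform distance for the max norm of R^n, which is at most
    the Euclidean one.

    Nonnegativity is the hypothesis [A4]. Lower semicontinuity comes from three facts.

    - The Hukuhara differences of the point [0,0] with the integrals of -f can
      only exist if these integrals are single points. The width of [f] is
      continuous and nonnegative, so it vanishes: [f] is singleton-valued
      ([hukuhara_singleton]).

    - The control system is therefore a scalar equation in disguise: a
      trajectory is a translate [x0 + c] with [c' = f(t, x0 + c, u)] and
      [c 0 = 0]. The Picard iteration ([picard_lindelof]) shows that
      trajectories exist, so that the cost is really an integral along a
      solution, and a Gronwall estimate ([gronwall]) shows that trajectories
      depend continuously on the control ([solution_cvg]).

    - The upper endpoint of [L] is lower semicontinuous in the usual sense,
      because [hi L <= b] holds exactly when [L] precedes the single point [b]
      ([ile_lsc_hi]). The Aumann integral is computed endpoint by endpoint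
      ([aumann_ends]), and Fatou's lemma passes semicontinuity from the
      integrand to the integral ([hi_cost_lsc]). *)

(** * Ekeland's variational principle *)

(** Descend greedily: [below u] collects the points that improve on [u] by at
    least [eps] times their distance to it. Choose [u k.+1] in [below (u k)]
    with almost minimal value there. The sets [below (u k)] decrease and their
    radii tend to 0, so the [u k] converge to a point of all of them, which no
    other point can improve on. [X] and [d] are only a set with a pseudo-distance
    so that the principle applies to functions restricted to a segment; lower
    semicontinuity is what excludes a better point at distance zero. *)
Lemma ekeland (R : realType) (V : Type) (X : set V) (d : V -> V -> R)
    (F : V -> R) (eps : R) :
  0 < eps -> X !=set0 ->
  (forall u, X u -> d u u = 0) ->
  (forall u v, X u -> X v -> 0 <= d u v) ->
  (forall u v, X u -> X v -> d u v = d v u) ->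
  (forall u v w, X u -> X v -> X w -> d u w <= d u v + d v w) ->
  (forall (u : nat -> V) (e : nat -> R), (forall k, X (u k)) ->
     e @ \oo --> (0 : R) ->
     (forall k m, (k <= m)%N -> d (u k) (u m) <= e k) ->
     exists2 v, X v & d (u k) v @[k --> \oo] --> (0 : R)) ->
  (forall u, X u -> 0 <= F u) ->
  (forall (u : nat -> V) v a, (forall k, X (u k)) -> X v ->
     d (u k) v @[k --> \oo] --> (0 : R) ->
     (\forall k \near \oo, F (u k) <= a) -> F v <= a) ->
  exists2 u0, X u0 & forall u, X u -> F u0 <= F u + eps * d u0 u.
Proof.
move=> eps0 [v0 Xv0] d0 d_ge0 dC d_tri Xcomplete F_ge0 F_lsc.
pose below u := [set v | X v /\ F v + eps * d u v <= F u].
have S_refl u : X u -> below u u by move=> Xu; split=> //; rewrite d0// mulr0 addr0.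
have S_trans u v w : X u -> below u v -> below v w -> below u w.
  move=> Xu [Xv uv] [Xw vw]; split=> //.
  have := ler_wpM2l (ltW eps0) (d_tri u v w Xu Xv Xw).
  by rewrite mulrDr; lra.
pose h k : R := 2^-1 ^+ k.
have h_gt0 k : 0 < h k by rewrite exprn_gt0// invr_gt0.
have h_cvg0 : h @ \oo --> (0 : R).
  by apply: cvg_expr; rewrite ger0_norm ?invr_ge0// invf_lt1// ltr1n.
pose P (ku : nat * V) v := X ku.2 ->
  below ku.2 v /\ forall w, below ku.2 w -> F v <= F w + h ku.1.
have [|g gP'] := @choice _ _ P.
  move=> [k u]; rewrite /P /=.
  have [Xu|nXu] := pselect (X u); last by exists u.
  have Finf : has_inf (F @` below u).
    split; first by exists (F u), u => //; exact: S_refl.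
    by exists 0 => _ [w [Xw _] <-]; exact: F_ge0.
  have [_ [v Suv <-] Fv] := inf_adherent (h_gt0 k) Finf.
  exists v => _; split=> // w Suw.
  rewrite (le_trans (ltW Fv))// lerD2r; apply: ge_inf; first exact: Finf.2.
  by exists w.
have gP k v : X v ->
    below v (g (k, v)) /\ forall w, below v w -> F (g (k, v)) <= F w + h k.
  exact: gP' (k, v).
pose u := fix u k := if k is k'.+1 then g (k', u k') else v0.
have Xu k : X (u k) by elim: k => //= k /(gP k)[[]].
have Su k m : (k <= m)%N -> below (u k) (u m).
  move=> /subnK <-; elim: (m - k)%N => [|j IH]; first exact: S_refl.
  exact: S_trans IH (gP _ _ (Xu _)).1.
have small k w : below (u k.+1) w -> eps * d (u k.+1) w <= h k.
  move=> Sw; have /(gP k _ (Xu k)).2 : below (u k) w.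
    exact: S_trans (gP _ _ (Xu k)).1 Sw.
  by move: Sw => [_]; rewrite -[g _]/(u k.+1); lra.
pose e k : R := h k / eps.
have e_cvg0 : e @ \oo --> (0 : R) by rewrite -(mul0r eps^-1); exact: cvgMl.
have dist_small k w : below (u k.+1) w -> d (u k.+1) w <= e k.
  by move=> /small; rewrite /e ler_pdivlMr// mulrC.
have [|u0 Xu0 u_cvg] := Xcomplete (fun k => u k.+1) e (fun k => Xu _) e_cvg0.
  by move=> k m km; apply/dist_small/Su.
have Su0 k : below (u k.+1) u0.
  split=> //; rewrite -lerBrDr; apply/ler_addgt0Pr => r r0.
  apply: (F_lsc (fun k => u k.+1) u0 _ (fun=> Xu _) Xu0 u_cvg).
  near=> m.
  have /= tri := d_tri _ _ _ (Xu k.+1) (Xu m.+1) Xu0.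
  have dm : eps * d (u m.+1) u0 <= r.
    rewrite mulrC -ler_pdivlMr//.
    near: m; apply: cvgr_le _ u_cvg _ _; rewrite divr_gt0//.
  have := ler_wpM2l (ltW eps0) tri.
  rewrite mulrDr => tri'.
  have km : (k.+1 <= m.+1)%N by near: m; exists k.
  by have [_] := Su _ _ km; rewrite /=; lra.
exists u0 => // w Xw; rewrite leNgt; apply/negP => Fw.
have Sw k : below (u k.+1) w.
  by apply: S_trans (Su0 k) _ => //; split => //; exact: ltW.
have d_le0 : d u0 w <= 0.
  apply/ler_addgt0Pr => r r0; rewrite add0r.
  near \oo => k.
  apply: le_trans (d_tri _ (u k.+1) _ Xu0 (Xu _) Xw) _.
  rewrite [r]splitr; apply: lerD.
    rewrite dC//; near: k; apply: cvgr_le _ u_cvg _ _; exact: divr_gt0.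
  apply: le_trans (dist_small _ _ (Sw k)) _.
  by near: k; apply: cvgr_le _ e_cvg0 _ _; exact: divr_gt0.
have d_eq0 : d u0 w = 0 by apply/eqP; rewrite eq_le d_le0 d_ge0.
have : F u0 <= F w.
  apply: (F_lsc (fun=> w) u0) => //; last exact: nearW.
  by rewrite dC// d_eq0; exact: cvg_cst.
by move: Fw; rewrite d_eq0; lra.
Unshelve. all: by end_near. Qed.

(** The uniform limit is stated with the rate [e], which is what both the
    completeness of the space of controls and the Picard iteration use. *)
Lemma uniform_cauchy_limit (R : realType) (Y : topologicalType)
    (V : completeNormedModType R) (A : set Y) (u : nat -> Y -> V)
    (e : nat -> R) :
  (forall k, {within A, continuous (u k)}) -> e @ \oo --> (0 : R) ->
  (forall k m t, (k <= m)%N -> A t -> `|u k t - u m t| <= e k) ->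
  exists2 v : Y -> V, {within A, continuous v} &
    forall k t, A t -> `|u k t - v t| <= e k.
Proof.
move=> u_cont e_cvg0 u_cauchy.
have cvg_u t : A t -> cvgn (u ^~ t).
  move=> At; apply/cauchy_cvgP/cauchy_exP => r r0.
  near \oo => k; exists (u k t); exists k => // m /= km.
  rewrite -ball_normE /=; apply: le_lt_trans (u_cauchy _ _ _ km At) _.
  by near: k; exact: cvgr_lt _ e_cvg0 _ r0.
pose v t := limn (u ^~ t).
have u_near_v k t : A t -> `|u k t - v t| <= e k.
  move=> At; have := cvg_u t At => cu.
  have : `|u k t - u m t| @[m --> \oo] --> `|u k t - v t|.
    by apply: cvg_norm; apply: cvgB => //; exact: cvg_cst.
  move=> /cvg_lim <- //; apply: limr_le.
    apply/cvg_ex; exists (`|u k t - v t|); apply: cvg_norm.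
    by apply: cvgB => //; exact: cvg_cst.
  by exists k => // m /= km; exact: u_cauchy.
exists v => //; apply/subspace_continuousP => t At.
apply/cvgrPdist_le => r r0.
near \oo => k.
have ek : e k <= r / 3.
  by near: k; apply: cvgr_le _ e_cvg0 _ _; exact: divr_gt0.
move/subspace_continuousP : (u_cont k) => /(_ t At)/cvgrPdist_le/(_ (r / 3)).
rewrite divr_gt0// => /(_ isT) near_u.
suff : \forall s \near nbhs t, A s -> `|v t - v s| <= r by [].
near=> s => As.
have near_us : A s -> `|u k t - u k s| <= r / 3 by near: s; exact: near_u.
have -> : v t - v s = (v t - u k t) + (u k t - u k s) + (u k s - v s).
  by rewrite !subrKA.
apply: le_trans (ler_normD _ _) _.
have := ler_normD (v t - u k t) (u k t - u k s).
have h1 : `|v t - u k t| <= e k by rewrite distrC u_near_v.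
have h2 := u_near_v k s As.
have h3 := near_us As.
by lra.
Unshelve. all: by end_near. Qed.

(** * The uniform distance of continuous functions *)

(* Lets row vectors serve as the values in [uniform_cauchy_limit]. *)
HB.instance Definition _ (R : realType) (n : nat) := Complete.on 'rV[R]_n.

Section supremum_distance.
Context {R : realType} {Y : topologicalType} {V : normedModType R}.
Variable A : set Y.
Hypotheses (A_cpt : compact A) (A_neq0 : A !=set0).
Implicit Types u v w : Y -> V.

Definition sup_dist u v : R := sup [set `|u t - v t| | t in A].

Lemma sup_dist_le u v c : (forall t, A t -> `|u t - v t| <= c) ->
  sup_dist u v <= c.
Proof.
move=> uvc; apply: ge_sup; last by move=> _ [t At <-]; exact: uvc.
by have [t At] := A_neq0; exists `|u t - v t|, t.
Qed.

Lemma le_sup_dist u v t : {within A, continuous u} -> {within A, continuous v} ->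
  A t -> `|u t - v t| <= sup_dist u v.
Proof.
move=> cu cv At; apply: ub_le_sup; last by exists t.
have cuv : {within A, continuous (fun s => u s - v s)}.
  by move=> s; apply: continuousB; [exact: cu|exact: cv].
have /compact_bounded[M [_ Mb]] := continuous_compact cuv A_cpt.
exists (M + 1) => _ [s As <-]; apply: (Mb (M + 1)) => //; first by rewrite ltrDl.
by exists s.
Qed.

Lemma sup_distxx u : sup_dist u u = 0.
Proof.
rewrite /sup_dist (_ : [set _ | _ in _] = [set 0]) ?sup1//.
apply/seteqP; split=> [_ [t _ <-]|_ ->] /=; first by rewrite subrr normr0.
by have [t At] := A_neq0; exists t => //; rewrite subrr normr0.
Qed.

Lemma sup_distC u v : sup_dist u v = sup_dist v u.
Proof. by rewrite /sup_dist; congr sup; apply: eq_imagel => t _; rewrite distrC. Qed.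

Lemma sup_dist_triangle u v w : {within A, continuous u} ->
  {within A, continuous v} -> {within A, continuous w} ->
  sup_dist u w <= sup_dist u v + sup_dist v w.
Proof.
move=> cu cv cw; apply: sup_dist_le => t At.
rewrite (le_trans (ler_distD (v t) _ _))//.
by apply: lerD; exact: le_sup_dist.
Qed.

End supremum_distance.

(** * Differential inequalities on a segment *)

Section differential_inequalities.
Context {R : realType}.
Implicit Types (T K t : R) (w g : R -> R).

Lemma is_derive_expM (a k t : R) :
  is_derive t 1 (fun s => a * expR (k * s)) (a * k * expR (k * t)).
Proof.
have h : is_derive t 1 (fun s : R => k * s) k.
  by apply: is_derive_eq; rewrite [LHS]mulr1.
apply: is_derive_eq.
by rewrite /GRing.scale /=; ring.
Qed.

(** Derivatives are required in the open segment only: there those of the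
    endpoints of a trajectory are two-sided. *)
Lemma is_derive_ge0_le T (h dh : R -> R) : {within `[0, T], continuous h} ->
  (forall t, t \in `]0, T[ -> is_derive t 1 h (dh t)) ->
  (forall t, t \in `]0, T[ -> 0 <= dh t) ->
  forall t, t \in `[0, T] -> h 0 <= h t.
Proof.
move=> ch Dh dh0 t t0T; move: (t0T); rewrite in_itv /= => /andP[t_ge0 tT].
have O : 0 \in `[0, T] by rewrite in_itv /= lexx (le_trans t_ge0).
apply: (@ger0_derive1_le_cc R h 0 T) => //.
  by move=> s s0T; have [] := Dh _ s0T.
by move=> s s0T; rewrite derive1E; have [_ ->] := Dh _ s0T; exact: dh0.
Qed.

(** Both [g - w] and [g + w] are nondecreasing. *)
Lemma derive_bound T w dw g dg :
  {within `[0, T], continuous w} -> {within `[0, T], continuous g} ->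
  (forall t, t \in `]0, T[ -> is_derive t 1 w (dw t)) ->
  (forall t, t \in `]0, T[ -> is_derive t 1 g (dg t)) ->
  (forall t, t \in `]0, T[ -> `|dw t| <= dg t) ->
  forall t, t \in `[0, T] -> `|w t - w 0| <= g t - g 0.
Proof.
move=> cw cg Dw Dg dwg t t0T.
have h1 : g 0 - w 0 <= g t - w t.
  apply: (is_derive_ge0_le T (fun s => g s - w s) (fun s => dg s - dw s)) t0T.
  - by move=> s; apply: continuousB; [exact: cg|exact: cw].
  - by move=> s s0T; apply: is_deriveB; [exact: Dg|exact: Dw].
  - by move=> s /dwg; rewrite ler_norml subr_ge0 => /andP[].
have h2 : g 0 + w 0 <= g t + w t.
  apply: (is_derive_ge0_le T (fun s => g s + w s) (fun s => dg s + dw s)) t0T.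
  - by move=> s; apply: continuousD; [exact: cg|exact: cw].
  - by move=> s s0T; apply: is_deriveD; [exact: Dg|exact: Dw].
  - by move=> s /dwg; rewrite ler_norml => /andP[? ?]; lra.
by rewrite ler_norml; apply/andP; split; lra.
Qed.

(** Squaring [w] avoids differentiating an absolute value: for [v = w ^ 2],
    [v' <= 2 |w| (K |w| + delta) <= (2 K + 1) v + delta ^ 2], so
    [delta ^ 2 t - v exp(- (2 K + 1) t)] is nondecreasing. *)
Lemma gronwall T K delta w dw : 0 <= K -> 0 <= delta ->
  {within `[0, T], continuous w} -> w 0 = 0 ->
  (forall t, t \in `]0, T[ -> is_derive t 1 w (dw t)) ->
  (forall t, t \in `]0, T[ -> `|dw t| <= K * `|w t| + delta) ->
  forall t, t \in `[0, T] ->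
    w t ^+ 2 <= delta ^+ 2 * T * expR ((2 * K + 1) * T).
Proof.
move=> K0 delta0 cw w0 Dw dw_le t t0T.
move: (t0T); rewrite in_itv /= => /andP[t_ge0 tT].
have O : 0 \in `[0, T] by rewrite in_itv /= lexx (le_trans t_ge0).
pose L := 2 * K + 1.
have L0 : 0 <= L by rewrite /L; lra.
pose E (s : R) := 1 * expR (- L * s).
pose h (s : R) := delta ^+ 2 * s - w s * w s * E s.
pose dh s := delta ^+ 2 - (dw s * w s + w s * dw s - L * (w s * w s)) * E s.
have cE : continuous E.
  move=> s; apply: differentiable_continuous; apply/derivable1_diffP.
  by have [] := is_derive_expM 1 (- L) s.
have cdelta : {within `[0, T], continuous (fun s : R => delta ^+ 2 * s)}.
  by apply: continuous_subspaceT => s; exact: mulrl_continuous.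
have cE' : {within `[0, T], continuous E} by exact: continuous_subspaceT.
have ch : {within `[0, T], continuous h}.
  move=> s; apply: continuousB.
    exact: cdelta.
  apply: continuousM; first by apply: continuousM; exact: cw.
  exact: cE'.
have : h 0 <= h t.
  have Dh s : s \in `]0, T[ -> is_derive s 1 h (dh s).
    move=> s0T; have := Dw s s0T => Ds; have := is_derive_expM 1 (- L) s => DE.
    apply: is_derive_eq.
    rewrite /dh /E /GRing.scale /= ?mulr0 ?addr0 ?mulr1; ring.
  apply: (is_derive_ge0_le T h dh ch Dh) t0T => s s0T.
  have E0 : 0 <= E s by rewrite /E mul1r expR_ge0.
  have E1 : E s <= 1.
    rewrite /E mul1r -expR0 ler_expR mulNr oppr_le0 mulr_ge0//.
    by move: s0T; rewrite in_itv /= => /andP[/ltW].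
  have wdw : 2 * (w s * dw s) <= L * (w s * w s) + delta ^+ 2.
    have b := dw_le s s0T.
    have : w s * dw s <= `|w s| * (K * `|w s| + delta).
      rewrite (le_trans (ler_norm _))// normrM ler_wpM2l//.
    have -> : w s * w s = `|w s| * `|w s| by rewrite -!expr2 real_normK ?num_real.
    have := sqr_ge0 (`|w s| - delta).
    rewrite /L !expr2; nra.
  have d2 := sqr_ge0 delta.
  by rewrite /dh; nra.
rewrite /h w0 mulr0 !mul0r subrr subr_ge0 -expr2 /E mul1r mulNr expRN.
rewrite ler_pdivrMr ?expR_gt0// => /le_trans; apply.
rewrite ler_pM ?mulr_ge0 ?sqr_ge0 ?expR_ge0//.
  by rewrite ler_wpM2l ?sqr_ge0.
by rewrite ler_expR ler_wpM2l.
Qed.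

End differential_inequalities.


(** * Existence for scalar Lipschitz equations *)

Section clamp.
Context {R : realType}.
Implicit Types T t : R.

(** Composition with [clamp T] extends functions continuous on [0, T] to
    functions continuous on R, so that the equations can be solved with two-sided
    derivatives even at 0 and T. *)
Definition clamp T t : R := Num.max 0 (Num.min t T).

Lemma clamp_itv T t : 0 <= T -> clamp T t \in `[0, T].
Proof. by move=> T0; rewrite in_itv /= /clamp le_max lexx ge_max T0 ge_min lexx orbT. Qed.

Lemma clamp_id T t : t \in `[0, T] -> clamp T t = t.
Proof. by rewrite in_itv /= /clamp => /andP[t0 tT]; rewrite min_l// max_r. Qed.

Lemma clamp_continuous T : continuous (clamp T).
Proof.
move=> t; apply: (@continuous_max _ _ (fun=> 0) (fun s => Num.min s T)).
  exact: cst_continuous.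
by apply: (@continuous_min _ _ id (fun=> T)); [exact: cvg_id|exact: cst_continuous].
Qed.

End clamp.

Lemma within_continuous_comp {X Y Z : topologicalType} (A : set X) (B : set Y)
    (f : Y -> Z) (g : X -> Y) :
  {within B, continuous f} -> {within A, continuous g} ->
  (forall x, A x -> B (g x)) -> {within A, continuous (f \o g)}.
Proof.
move=> /subspace_continuousP cf /subspace_continuousP cg AB.
apply/subspace_continuousP => x Ax.
apply: (@cvg_comp _ _ _ g f _ (within B (nbhs (g x)))); last exact/cf/AB.
move=> P nP; have nAP : within A (nbhs x) [set z | B (g z) -> P (g z)].
  exact: (cg x Ax _ nP).
apply: (@filterS _ (nbhs x) _ [set z | A z -> B (g z) -> P (g z)]); last exact: nAP.
by move=> z /= BP Az; exact: BP Az (AB z Az).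
Qed.

Section picard.
Context {R : realType}.

(** The integral starts from -1, so that the fundamental theorem of calculus
    applies at both sides of 0. *)
Lemma antiderivative (T : R) (psi : R -> R) : 0 < T -> continuous psi ->
  exists G : R -> R, G 0 = 0 /\
    forall t, t \in `[0, T] -> is_derive t 1 G (psi t).
Proof.
move=> T0 cpsi.
pose F x := (\int[@lebesgue_measure R]_(t in `[-1, x]) psi t)%R.
exists (fun x => F x - F 0); split; first by rewrite subrr.
move=> t; rewrite in_itv /= => /andP[t0 tT].
have ipsi : (@lebesgue_measure R).-integrable `[-1, T + 1] (EFin \o psi).
  apply: continuous_compact_integrable; first exact: segment_compact.
  exact: continuous_subspaceT.
have tT1 : t < T + 1 by lra.
have t1 : -1 < t by lra.
have [dF F'] := continuous_FTC1_closed tT1 ipsi t1 (cpsi t).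
have DF : is_derive t 1 F (psi t) by split; [exact: dF|rewrite -derive1E F'].
by apply: is_derive_eq; rewrite ?subr0 ?oppr0 ?addr0.
Qed.

Lemma geometric_cauchy (V : normedModType R) (x : nat -> V) (C : R) :
  (forall k, `|x k.+1 - x k| <= C * 2^-1 ^+ k) ->
  forall k m, (k <= m)%N -> `|x k - x m| <= 2 * C * 2^-1 ^+ k.
Proof.
move=> xC k m /subnK <-; move: (m - k)%N => j; elim: j k => [|j IH] k.
  have C0 : 0 <= C by have := le_trans (normr_ge0 _) (xC 0%N); rewrite expr0 mulr1.
  by rewrite add0n subrr normr0 !mulr_ge0// exprn_ge0// invr_ge0.
have := IH k.+1; rewrite addnS -addSn => IHk.
rewrite (le_trans (ler_distD (x k.+1) _ _))//.
have := xC k; rewrite distrC; move: IHk; rewrite exprS; lra.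
Qed.

(** The iterates [c k] satisfy [|c k.+1 - c k| <= M 2^-k exp(2 K t)]: the weight
    [exp(2 K t)] turns the Lipschitz constant into a contraction by one half, so
    that the iteration converges on the whole segment. The limit is identified by
    comparing derivatives, since [step y] and [c k.+1] have derivatives at
    distance at most [K * e k]. *)
Lemma picard_lindelof (T K : R) (phi : R -> R -> R) : 0 < T -> 0 < K ->
  continuous (fun p : R * R => phi p.1 p.2) ->
  (forall t c1 c2, t \in `[0, T] -> `|phi t c1 - phi t c2| <= K * `|c1 - c2|) ->
  exists c : R -> R, c 0 = 0 /\
    forall t, t \in `[0, T] -> is_derive t 1 c (phi t (c t)).
Proof.
move=> T0 K0 cphi lip.
have O : 0 \in `[0, T] by rewrite in_itv /= lexx ltW.
have [A A_prim] : {A : (R -> R) -> R -> R & forall psi, continuous psi ->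
    A psi 0 = 0 /\ forall t, t \in `[0, T] -> is_derive t 1 (A psi) (psi t)}.
  apply: (@choice _ _ (fun psi G => continuous psi -> G 0 = 0 /\
    forall t, t \in `[0, T] -> is_derive t 1 G (psi t))) => psi.
  have [cpsi|ncpsi] := pselect (continuous psi); last by exists psi.
  by have [G HG] := antiderivative T psi T0 cpsi; exists G.
pose step (c : R -> R) := A (fun t => phi t (c (clamp T t))).
have step_prim c : {within `[0, T], continuous c} -> step c 0 = 0 /\
    forall t, t \in `[0, T] -> is_derive t 1 (step c) (phi t (c t)).
  move=> cc.
  have ccl : continuous (c \o clamp T).
    apply/continuous_subspace_setT.
    apply: (within_continuous_comp setT _ c (clamp T) cc).
      exact: (continuous_subspaceT (clamp_continuous T)).
    by move=> t _; apply: clamp_itv; exact: ltW.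
  have cpsi : continuous (fun t => phi t (c (clamp T t))).
    move=> t; apply: (continuous_comp (f := fun t => (t, c (clamp T t)))
      (g := fun p : R * R => phi p.1 p.2)); last exact: cphi.
    apply: (@cvg_pair _ _ _ (nbhs t) (nbhs t) (nbhs (c (clamp T t)))).
      exact: cvg_id.
    exact: ccl.
  have [s0 Ds] := A_prim _ cpsi; split=> // t t0T.
  by have := Ds t t0T; rewrite clamp_id.
have sub t : t \in `]0, T[ -> t \in `[0, T] by apply: subset_itv_oo_cc.
have derive_within (c dc : R -> R) :
    (forall t, t \in `[0, T] -> is_derive t 1 c (dc t)) ->
    {within `[0, T], continuous c}.
  move=> Dc; apply: derivable_within_continuous => t t0T.
  by have [] := Dc t t0T.
have step_cont c : {within `[0, T], continuous c} ->
    {within `[0, T], continuous (step c)}.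
  by move=> /step_prim[_]; exact: derive_within.
pose c k := iter k step (fun=> 0).
have cc k : {within `[0, T], continuous (c k)}.
  elim: k => [|k IH]; last exact: step_cont.
  by apply: continuous_subspaceT => t; exact: cst_continuous.
have step_dist (c1 c2 g dg : R -> R) : {within `[0, T], continuous c1} ->
    {within `[0, T], continuous c2} -> {within `[0, T], continuous g} ->
    (forall t, t \in `]0, T[ -> is_derive t 1 g (dg t)) ->
    (forall t, t \in `[0, T] -> K * `|c1 t - c2 t| <= dg t) ->
    forall t, t \in `[0, T] -> `|step c1 t - step c2 t| <= g t - g 0.
  move=> cc1 cc2 cg Dg c12 t t0T.
  have [s1 D1] := step_prim _ cc1; have [s2 D2] := step_prim _ cc2.
  have -> : step c1 t - step c2 t =
      (step c1 t - step c2 t) - (step c1 0 - step c2 0).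
    by rewrite s1 s2 !subr0.
  pose w s := step c1 s - step c2 s.
  pose dw s := phi s (c1 s) - phi s (c2 s).
  have cw : {within `[0, T], continuous w}.
    by move=> s; apply: continuousB; exact: step_cont.
  have b := derive_bound T w dw g dg cw.
  have b1 := b cg.
  have Dw s : s \in `]0, T[ -> is_derive s 1 w (dw s).
    by move=> /sub s0T; apply: is_deriveB; [exact: D1|exact: D2].
  have b2 := b1 Dw Dg.
  apply: b2 t t0T.
  by move=> s /sub s0T; exact: le_trans (lip _ _ _ s0T) (c12 _ s0T).
have [M M_ge0 c1M] : exists2 M, 0 <= M & forall t, t \in `[0, T] -> `|c 1%N t| <= M.
  have /compact_bounded[M [_ Mb]] :=
    continuous_compact (cc 1%N) (@segment_compact R 0 T).
  have c1b t : t \in `[0, T] -> `|c 1%N t| <= M + 1.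
    by move=> t0T; apply: (Mb (M + 1)); [rewrite ltrDl|exists t].
  by exists (M + 1) => //; exact: le_trans (normr_ge0 _) (c1b _ O).
have c_geom k t : t \in `[0, T] ->
    `|c k.+1 t - c k t| <= M * 2^-1 ^+ k * expR (2 * K * t).
  elim: k t => [|k IH] t t0T.
    rewrite subr0 expr0 mulr1 (le_trans (c1M t t0T))// ler_peMr//.
    move: t0T; rewrite in_itv /= => /andP[t_ge0 _].
    by rewrite -expR0 ler_expR !mulr_ge0// ltW.
  pose g s := M * 2^-1 ^+ k.+1 * expR (2 * K * s).
  have Dg s := is_derive_expM (M * 2^-1 ^+ k.+1) (2 * K) s.
  have cg : {within `[0, T], continuous g}.
    by apply: (derive_within g) => s _; exact: Dg.
  have /= := step_dist (c k.+1) (c k) g _ (cc _) (cc _) cg (fun s _ => Dg s) _ t t0T.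
  have g0 : 0 <= g 0.
    by rewrite /g !mulr_ge0 ?exprn_ge0 ?invr_ge0 ?expR_ge0.
  move=> bound; apply: (le_trans (bound _)); last by rewrite -/(g t); lra.
  move=> s s0T; rewrite exprS.
  apply: le_trans (ler_wpM2l (ltW K0) (IH s s0T)) _.
  by rewrite le_eqVlt; apply/orP; left; apply/eqP; field.
pose C := M * expR (2 * K * T).
have c_cauchy k m t : (k <= m)%N -> t \in `[0, T] ->
    `|c k t - c m t| <= 2 * C * 2^-1 ^+ k.
  move=> km t0T; apply: (geometric_cauchy _ (fun k => c k t)) => // j.
  rewrite (le_trans (c_geom j t t0T))// /C mulrAC ler_wpM2r ?exprn_ge0 ?invr_ge0//.
  have K2 : 0 <= 2 * K by lra.
  rewrite ler_wpM2l// ler_expR ler_wpM2l//.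
  by move: t0T; rewrite in_itv /= => /andP[].
pose e k : R := 2 * C * 2^-1 ^+ k.
have e_cvg0 : e @ \oo --> (0 : R).
  rewrite -(mulr0 (2 * C)); apply: cvgMr.
  by apply: cvg_expr; rewrite ger0_norm ?invr_ge0// invf_lt1// ltr1n.
have [y cy c_near_y] := uniform_cauchy_limit _ _ _ _ c e cc e_cvg0 c_cauchy.
have y_fixed t : t \in `[0, T] -> y t = step y t.
  move=> t0T; apply/eqP; rewrite -subr_eq0 -normr_le0.
  apply/ler_addgt0Pr => r r0; rewrite add0r.
  near \oo => k.
  have ek : e k <= r / (1 + K * T).
    near: k; apply: cvgr_le _ e_cvg0 _ _; rewrite divr_gt0// addr_gt0// mulr_gt0//.
  have ek1 : e k.+1 <= e k.
    rewrite /e exprS mulrCA ler_piMl ?invf_le1 ?ler1n//.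
    by rewrite !mulr_ge0 ?expR_ge0 ?exprn_ge0 ?invr_ge0.
  have h1 : `|y t - c k.+1 t| <= e k.+1 by rewrite distrC; exact: c_near_y.
  have h2 : `|c k.+1 t - step y t| <= K * e k * t.
    have Dg (s : R) : is_derive s 1 (fun x : R => K * e k * x) (K * e k).
      by apply: is_derive_eq; rewrite /GRing.scale /= ?mulr0 ?mulr1 ?addr0 ?add0r.
    have cg : {within `[0, T], continuous (fun x : R => K * e k * x)}.
      by apply: (derive_within _ (fun=> K * e k)) => s _; exact: Dg.
    have := step_dist (c k) y _ _ (cc k) cy cg (fun s _ => Dg s) _ t t0T.
    rewrite mulr0 subr0; apply => s s0T.
    by rewrite ler_wpM2l ?(ltW K0)//; exact: c_near_y.
  rewrite (le_trans (ler_distD (c k.+1 t) _ _))//.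
  have KT : 0 < 1 + K * T by rewrite addr_gt0// mulr_gt0.
  move: ek; rewrite ler_pdivlMr// => ek.
  have e0 : 0 <= e k by apply: le_trans (normr_ge0 _) (c_near_y k t t0T).
  have tT : t <= T by move: t0T; rewrite in_itv /= => /andP[].
  have := ler_wpM2l (mulr_ge0 (ltW K0) e0) tT.
  by lra.
have [s0 Ds] := step_prim _ cy.
by exists (step y); split=> // t t0T; rewrite -y_fixed//; exact: Ds.
Unshelve. all: by end_near. Qed.

End picard.

(** * Endpoints of the Aumann integral *)

Section lebesgue_measurability.
Context {R : realType}.
Notation mu := (@completed_lebesgue_measure R).
Notation lebesgueT := (caratheodory_type ((@wlength R idfun)^*)%mu).
Implicit Types (a b : R) (g : R -> cbitv R).

Lemma borel_lebesgue_measurable (A : set R) :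
  measurable (A : set (measurableTypeR R)) -> measurable (A : set lebesgueT).
Proof. exact: sub_caratheodory. Qed.

Lemma lebesgue_measurable_itv (i : interval R) :
  measurable ([set` i] : set lebesgueT).
Proof. exact: borel_lebesgue_measurable. Qed.

Lemma completed_lebesgue_measure_itvcc a b :
  a <= b -> mu (`[a, b] : set lebesgueT) = (b - a)%:E.
Proof.
move=> ab; rewrite -[LHS]/(lebesgue_measure (`[a, b] : set R)).
rewrite lebesgue_measure_itv /= lte_fin; case: ltgtP ab => // -> _.
by rewrite subrr.
Qed.

Lemma within_continuous_integrable a b (w : R -> R) : a <= b ->
  {within `[a, b], continuous w} -> mu.-integrable `[a, b] (EFin \o w).
Proof.
move=> ab w_cont; apply: measurable_bounded_integrable.
- exact: lebesgue_measurable_itv.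
- by have := ltry (b - a); rewrite -(completed_lebesgue_measure_itvcc _ _ ab).
- move=> mD B mB; apply: borel_lebesgue_measurable.
  exact: subspace_continuous_measurable_fun.
- have /compact_bounded[M [_ mrt]] :=
    continuous_compact w_cont (@segment_compact R a b).
  by exists M; split; rewrite ?num_real // => ? ? ? ?; exact: mrt.
Qed.

(** [lo (g t) <= r] holds exactly when [g t] meets the half-line below [r]. *)
Lemma imeasurable_lo a b g : imeasurable a b g ->
  measurable_fun (`[a, b] : set lebesgueT) (fun t : lebesgueT => lo (g t)).
Proof.
move=> mg; apply: (measurability _ (RGenOInfty.measurableE R)).
move=> _ [_ [r ->] <-].
rewrite (_ : _ `&` _ = `[a, b] `\`
  [set t | t \in `[a, b] /\ points (g t) `&` `]-oo, r] !=set0]).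
  by apply: measurableD; [exact: lebesgue_measurable_itv | apply: mg].
apply/seteqP; split=> t /= [tab]; rewrite ?in_itv /= ?andbT.
  move=> rlo; split=> // -[_ [y [/andP[loy _] /=]]].
  by rewrite in_itv /=; lra.
move=> ngt; rewrite ltNge; split => //; apply/negP => lor; apply: ngt; split => //.
by exists (lo (g t)); rewrite /points /= lexx in_itv /=; split=> //; exact: ends_le.
Qed.

(** [r <= hi (g t)] holds exactly when [g t] meets the half-line above [r]. *)
Lemma imeasurable_hi a b g : imeasurable a b g ->
  measurable_fun (`[a, b] : set lebesgueT) (fun t : lebesgueT => hi (g t)).
Proof.
move=> mg; apply: (measurability _ (RGenCInfty.measurableE R)).
move=> _ [_ [r ->] <-].
rewrite (_ : _ `&` _ =
  [set t | t \in `[a, b] /\ points (g t) `&` `[r, +oo[ !=set0]).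
  by apply: mg; exact: rray_closed.
apply/seteqP; split=> t /= [tab]; rewrite ?in_itv /= ?andbT.
  move=> rhi; split=> //; exists (hi (g t)).
  by rewrite /points /= lexx andbT in_itv /= andbT; split=> //; exact: ends_le.
move=> [y [/andP[_ yhi]]] /=; rewrite in_itv /= andbT => ry.
by split=> //; exact: le_trans yhi.
Qed.

Lemma points_lo (A : cbitv R) : points A (lo A).
Proof. by rewrite /points /= lexx; exact: ends_le. Qed.

Lemma points_hi (A : cbitv R) : points A (hi A).
Proof. by rewrite /points /= lexx andbT; exact: ends_le. Qed.

Lemma integrably_bounded_integrable a b g :
  imeasurable a b g -> integrably_bounded a b g ->
  mu.-integrable `[a, b] (EFin \o (lo \o g)) /\
  mu.-integrable `[a, b] (EFin \o (hi \o g)).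
Proof.
move=> mg [k [k_int k_ge0 gk]].
have D := lebesgue_measurable_itv `[a, b].
split; apply: (le_integrable D _ _ k_int).
- by apply/measurable_EFinP; exact: imeasurable_lo.
- move=> t Dt /=; rewrite lee_fin [leRHS]ger0_norm ?k_ge0//.
  by apply: (gk _ Dt); exact: points_lo.
- by apply/measurable_EFinP; exact: imeasurable_hi.
- move=> t Dt /=; rewrite lee_fin [leRHS]ger0_norm ?k_ge0//.
  by apply: (gk _ Dt); exact: points_hi.
Qed.

(** Every value between the integrals of [lo \o g] and [hi \o g] is the integral
    of a constant convex combination of these two selections, so the set of
    integrals of selections is the segment between them. *)
Lemma aumann_ends a b g :
  mu.-integrable `[a, b] (EFin \o (lo \o g)) ->
  mu.-integrable `[a, b] (EFin \o (hi \o g)) ->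
  lo (aumann a b g) = \int[mu]_(t in `[a, b]) lo (g t) /\
  hi (aumann a b g) = \int[mu]_(t in `[a, b]) hi (g t).
Proof.
move=> ilo ihi; have D := lebesgue_measurable_itv `[a, b].
set l := \int[mu]_(t in _) lo _; set h := \int[mu]_(t in _) hi _.
have lh : l <= h by apply: le_Rintegral => // t _; exact: ends_le.
pose C := @CBItv R (l, h) lh.
have CE : points C = aumann_set a b g.
  apply/seteqP; split=> r /=.
    rewrite /points /lo /hi /= => /andP[lr rh].
    have [lh_eq|lh_neq] := eqVneq l h.
      exists (lo \o g); split => //; first by move=> t _; exact: points_lo.
      transitivity l => //.
      by apply/eqP; rewrite eq_le lr lh_eq rh.
    have lh_gt0 : 0 < h - l by rewrite subr_gt0 lt_neqAle lh_neq.
    pose th := (r - l) / (h - l).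
    have th_ge0 : 0 <= th by rewrite divr_ge0 ?subr_ge0.
    have th_le1 : th <= 1 by rewrite ler_pdivrMr// mul1r lerD2r.
    have iw : mu.-integrable `[a, b] (EFin \o (fun t => hi (g t) - lo (g t))).
      exact: (integrableB D ihi ilo).
    have ithw : mu.-integrable `[a, b]
        (EFin \o (fun t => th * (hi (g t) - lo (g t)))).
      exact: (integrableZl D th iw).
    exists (fun t => lo (g t) + th * (hi (g t) - lo (g t))); split.
    - exact: (integrableD D ilo ithw).
    - move=> t _; have := ends_le (g t).
      rewrite -/(lo (g t)) -/(hi (g t)) /points /= => lohi.
      by apply/andP; split; nra.
    - rewrite RintegralD// RintegralZl// RintegralB// -/l -/h /th divfK.
        by rewrite addrC subrK.
      by rewrite gt_eqF.
  move=> [gamma [igamma gammaP ->]]; rewrite /points /lo /hi /=.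
  apply/andP; split; apply: le_Rintegral => // t /= Dt.
    by have /andP[] := gammaP _ Dt.
  by have /andP[] := gammaP _ Dt.
(* An interval is determined by its points, so it remains to compare them. *)
have /= : points (aumann a b g) = points C.
  rewrite CE; apply: (@getPex _ [set A | points A = aumann_set a b g]).
  by exists C.
move: (aumann a b g) => A AC.
have := points_lo A; have := points_hi A; rewrite AC.
have := points_lo C; have := points_hi C; rewrite -{1 2}AC.
rewrite /points /= {2 4}/lo {1 3}/hi /= => /andP[? ?] /andP[? ?] /andP[? ?] /andP[? ?].
by split; apply/eqP; rewrite eq_le; apply/andP.
Qed.

(** A positive value of [w] would persist on a nondegenerate segment. *)
Lemma continuous_integral0 a b (w : R -> R) : a < b ->
  {within `[a, b], continuous w} -> (forall t, t \in `[a, b] -> 0 <= w t) ->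
  \int[mu]_(t in `[a, b]) w t <= 0 -> forall t, t \in `[a, b] -> w t = 0.
Proof.
move=> ab w_cont w_ge0 int_le0 t0 t0ab; apply/eqP; rewrite eq_le w_ge0// andbT.
rewrite leNgt; apply/negP => w_gt0.
move/subspace_continuousP : (w_cont) => /(_ _ t0ab)/cvgrPdist_lt.
move=> /(_ (w t0 / 2)); rewrite divr_gt0// => /(_ isT)/nbhs_ballP[r /= r0 near_t0].
pose p := Num.max a (t0 - r / 2); pose q := Num.min b (t0 + r / 2).
move: (t0ab); rewrite in_itv /= => /andP[at0 t0b].
have pq : p < q.
  by rewrite /p /q gt_max !lt_min; apply/andP; split; apply/andP; split; lra.
have sub : `[p, q] `<=` `[a, b].
  by apply: subset_itv; rewrite bnd_simp ?le_max ?ge_min lexx.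
have w_big t : t \in `[p, q] -> w t0 / 2 <= w t.
  move=> tpq; have tab := sub _ tpq.
  have : ball t0 r t.
    rewrite /ball /= ltr_norml; move: tpq.
    by rewrite in_itv /= /p /q ge_max le_min => /andP[/andP[? ?] /andP[? ?]]; lra.
  move=> /near_t0 /(_ tab) wt.
  have : `|w t0 - w t| < w t0 / 2 by [].
  by rewrite ltr_norml => /andP[? ?]; lra.
have iw := within_continuous_integrable _ _ _ (ltW ab) w_cont.
have fin_int : \int[mu]_(t in `[a, b]) w t =
    fine (\int[mu]_(t in `[a, b]) (w t)%:E) by [].
have : ((w t0 / 2 * (q - p))%:E <= \int[mu]_(t in `[a, b]) (w t)%:E)%E.
  have Dpq := lebesgue_measurable_itv `[p, q].
  have Dab := lebesgue_measurable_itv `[a, b].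
  have mw := measurable_int _ iw.
  have part : (\int[mu]_(t in `[p, q]) (w t)%:E <=
      \int[mu]_(t in `[a, b]) (w t)%:E)%E.
    apply: ge0_subset_integral Dpq Dab _ mw _ sub.
    by move=> t /w_ge0 wt; rewrite lee_fin.
  apply: le_trans part.
  rewrite EFinM -(completed_lebesgue_measure_itvcc _ _ (ltW pq)) -integral_cst//.
  apply: (ge0_le_integral _ Dpq).
  - by move=> t _ /=; rewrite lee_fin divr_ge0// ltW.
  - exact: measurable_cst.
  - exact: measurable_funS Dab sub mw.
  - by move=> t /w_big wt; rewrite lee_fin.
rewrite -(fineK (integrable_fin_num _ iw))//; last exact: lebesgue_measurable_itv.
rewrite lee_fin -fin_int => /le_trans /(_ int_le0).
by rewrite leNgt mulr_gt0// ?subr_gt0// divr_gt0.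
Qed.

End lebesgue_measurability.

(** * Intervals and their (ii)-derivatives *)

Section interval_topology.
Context {R : realType}.
Implicit Types (A B C : cbitv R) (r : R).

Lemma cbitv_ext A B : lo A = lo B -> hi A = hi B -> A = B.
Proof.
by move=> l h; apply: dH_eq0; rewrite /dH l h !subrr normr0 maxxx.
Qed.

Lemma lo_iadd A B : lo (iadd A B) = lo A + lo B. Proof. by []. Qed.

Lemma hi_iadd A B : hi (iadd A B) = hi A + hi B. Proof. by []. Qed.

Lemma lo_isingle r : lo (isingle r) = r. Proof. by []. Qed.

Lemma hi_isingle r : hi (isingle r) = r. Proof. by []. Qed.

Lemma lo_dist A B : `|lo A - lo B| <= dH A B.
Proof. by rewrite /dH le_max lexx. Qed.

Lemma hi_dist A B : `|hi A - hi B| <= dH A B.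
Proof. by rewrite /dH le_max lexx orbT. Qed.

Lemma nbhs_dH A (P : set (cbitv R)) (e : R) : 0 < e ->
  (forall B, dH A B < e -> P B) -> nbhs A P.
Proof. by move=> e0 AP; apply/(nbhs_ballP A); exists e. Qed.

Lemma lo_continuous : continuous (@lo R).
Proof.
move=> A; have nbhsF := nbhs_filter A; apply/cvgrPdist_lt => e e0.
suff: nbhs A [set B | `|lo A - lo B| < e] by [].
apply: (nbhs_dH A _ e e0) => B; exact: le_lt_trans (lo_dist A B).
Qed.

Lemma hi_continuous : continuous (@hi R).
Proof.
move=> A; have nbhsF := nbhs_filter A; apply/cvgrPdist_lt => e e0.
suff: nbhs A [set B | `|hi A - hi B| < e] by [].
apply: (nbhs_dH A _ e e0) => B; exact: le_lt_trans (hi_dist A B).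
Qed.

Lemma cvg_cbitv {T : Type} (F : set_system T) {FF : Filter F}
    (x : T -> cbitv R) A :
  dH A (x t) @[t --> F] --> (0 : R) -> x t @[t --> F] --> A.
Proof.
move=> dx; apply/cvg_ballP => e e0; rewrite near_simpl.
have := cvgr_lt _ dx _ e0; exact.
Qed.

Lemma dH_translate A r s : dH (iadd A (isingle r)) (iadd A (isingle s)) = `|r - s|.
Proof.
have shiftB (a : R) : a + r - (a + s) = r - s by ring.
by rewrite /dH /iadd /isingle /lo /hi /= !shiftB maxxx.
Qed.

Lemma translate_continuous A : continuous (fun r => iadd A (isingle r)).
Proof.
move=> r.
have dist0 : `|r - s| @[s --> r] --> (0 : R).
  have zeroE : `|r - r| = 0 by rewrite subrr normr0.
  by rewrite -zeroE; apply: cvg_norm; apply: cvgB; [exact: cvg_cst|exact: cvg_id].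
suff : dH (iadd A (isingle r)) (iadd A (isingle s)) @[s --> r] --> (0 : R).
  exact: cvg_cbitv.
by under eq_fun do rewrite dH_translate.
Qed.

Lemma isingle_continuous : continuous (@isingle R).
Proof.
have <- : (fun r => iadd (isingle 0) (isingle r)) = @isingle R.
  by apply/funext => r; apply: cbitv_ext; rewrite /lo /hi /= add0r.
exact: translate_continuous.
Qed.

Lemma hdiff_iadd A C : hdiff (iadd A C) A = C.
Proof.
rewrite /hdiff.
have /= : [set C' | iadd A C = iadd A C']
    (get [set C' | iadd A C = iadd A C']).
  by apply: getPex; exists C.
move: (get _) => C' E; apply: cbitv_ext.
  by have := congr1 lo E; rewrite !lo_iadd => /addrI ->.
by have := congr1 hi E; rewrite !hi_iadd => /addrI ->.
Qed.

Lemma iadd_hdiff A B : hdiff_exists A B -> A = iadd B (hdiff A B).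
Proof. by move=> [C ->]; rewrite hdiff_iadd. Qed.

Lemma iscale_isingle r s : iscale r (isingle s) = isingle (r * s).
Proof. by apply: cbitv_ext; rewrite /iscale /scale_ends /lo /hi /=; case: ifP. Qed.

Lemma lo_iscale_neg r A : r < 0 -> lo (iscale r A) = r * hi A.
Proof. by move=> r0; rewrite /iscale /scale_ends {1}/lo /= leNgt r0. Qed.

Lemma hi_iscale_neg r A : r < 0 -> hi (iscale r A) = r * lo A.
Proof. by move=> r0; rewrite /iscale /scale_ends {1}/hi /= leNgt r0. Qed.

End interval_topology.

Section ii_derivative.
Context {R : realType}.
Implicit Types (T t : R) (x : R -> cbitv R).

(** Difference quotients that are one-sided at 0 and T give continuity up to these
    endpoints, which is all that comparison by derivatives requires there. *)
Lemma one_sided_derive (T : R) (w dw : R -> R) : 0 < T ->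
  (forall t, t \in `[0, T] -> 0 < t ->
     h^-1 * (w (t + h) - w t) @[h --> (0 : R)^'-] --> dw t) ->
  (forall t, t \in `[0, T] -> t < T ->
     h^-1 * (w (t + h) - w t) @[h --> (0 : R)^'+] --> dw t) ->
  {within `[0, T], continuous w} /\
  forall t, t \in `]0, T[ -> is_derive t 1 w (dw t).
Proof.
move=> T0 Dl Dr.
have Dw t : t \in `]0, T[ -> is_derive t 1 w (dw t).
  move=> tT; have tT' : t \in `[0, T] by apply: subset_itv_oo_cc tT.
  move: tT; rewrite in_itv /= => /andP[t_gt0 t_lt].
  have D : h^-1 *: (w (h *: 1 + t) - w t) @[h --> (0 : R)^'] --> dw t.
    under eq_fun do rewrite [_ *: 1]mulr1 [_ + t]addrC.
    exact: (@cvg_at_right_left_dnbhs R R^o _ 0 _ (Dr t tT' t_lt) (Dl t tT' t_gt0)).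
  by split; [apply/cvg_ex; exists (dw t)|exact/cvg_lim].
have O : 0 \in `[0, T] by rewrite in_itv /= lexx ltW.
have TT : T \in `[0, T] by rewrite in_itv /= lexx ltW.
split=> //; apply/(continuous_within_itvP _ T0); split.
- move=> t tT; apply/differentiable_continuous/derivable1_diffP.
  by have [] := Dw t tT.
- have := Dr 0 O T0 => D.
  have : h * (h^-1 * (w (0 + h) - w 0)) + w 0 @[h --> (0 : R)^'+]
      --> 0 * dw 0 + w 0.
    apply: cvgD; last exact: cvg_cst.
    by apply: cvgM => //; exact: cvg_at_right_filter.
  rewrite mul0r add0r; apply: cvg_trans; apply: near_eq_cvg; near=> h.
  by rewrite mulVKf ?gt_eqF// subrK add0r.
- have := Dl T TT T0 => D.
  have : (h - T) * ((h - T)^-1 * (w (T + (h - T)) - w T)) + w T @[h --> T^'-]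
      --> 0 * dw T + w T.
    apply: cvgD; last exact: cvg_cst.
    have hT : h - T @[h --> T^'-] --> (0 : R)^'-.
      move=> P; rewrite /= /at_left /within /= => -[e /= e0 eP].
      exists e => //= h hTe hT; apply: eP; last by rewrite subr_lt0.
      by rewrite /= sub0r opprB.
    apply: cvgM; first exact: cvg_trans hT (@cvg_within _ _ _ _).
    exact: (cvg_comp _ _ hT D).
  rewrite mul0r add0r; apply: cvg_trans; apply: near_eq_cvg; near=> h.
  rewrite mulVKf ?subrK ?[T + _]addrC ?subrK//.
  by rewrite subr_eq0 lt_eqF.
Unshelve. all: by end_near. Qed.

Lemma cvg_at_leftN (w : R -> R) (l : R) :
  w (- h) @[h --> (0 : R)^'-] --> l -> w h @[h --> (0 : R)^'+] --> l.
Proof. by move=> wl; apply/cvg_at_rightNP; rewrite oppr0. Qed.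

(** Multiplication by [h^-1 < 0] swaps the endpoints of a Hukuhara difference, so
    the lower endpoint of [D] is the derivative of the upper endpoint of [x] and
    conversely; both endpoints have the same derivative when [D] is a point. *)
Lemma ii_derive_ends T t x D : lo D = hi D -> is_ii_derive 0 T x t D ->
  (0 < t ->
     h^-1 * (lo (x (t + h)) - lo (x t)) @[h --> (0 : R)^'-] --> lo D /\
     h^-1 * (hi (x (t + h)) - hi (x t)) @[h --> (0 : R)^'-] --> lo D) /\
  (t < T ->
     h^-1 * (lo (x (t + h)) - lo (x t)) @[h --> (0 : R)^'+] --> lo D /\
     h^-1 * (hi (x (t + h)) - hi (x t)) @[h --> (0 : R)^'+] --> lo D).
Proof.
move=> DE [Dl Dr]; split=> tT.
  have [ex q] := Dl tT.
  have ql : hi (iscale h^-1 (hdiff (x (t + h)) (x t))) @[h --> (0 : R)^'-] --> hi D.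
    exact: (cvg_comp _ _ q (hi_continuous D)).
  have qh : lo (iscale h^-1 (hdiff (x (t + h)) (x t))) @[h --> (0 : R)^'-] --> lo D.
    exact: (cvg_comp _ _ q (lo_continuous D)).
  split; [rewrite DE; apply: cvg_trans ql|apply: cvg_trans qh];
    apply: near_eq_cvg; near=> h;
    (have h0 : h^-1 < 0 by rewrite invr_lt0);
    (have E : x (t + h) = iadd (x t) (hdiff (x (t + h)) (x t))
      by apply: iadd_hdiff; near: h).
    by rewrite hi_iscale_neg// [in RHS]E lo_iadd [lo (x t) + _]addrC addrK.
  by rewrite lo_iscale_neg// [in RHS]E hi_iadd [hi (x t) + _]addrC addrK.
have [ex q] := Dr tT.
have ql : hi (iscale h^-1 (hdiff (x t) (x (t - h)))) @[h --> (0 : R)^'-] --> hi D.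
  exact: (cvg_comp _ _ q (hi_continuous D)).
have qh : lo (iscale h^-1 (hdiff (x t) (x (t - h)))) @[h --> (0 : R)^'-] --> lo D.
  exact: (cvg_comp _ _ q (lo_continuous D)).
split; apply: cvg_at_leftN; [rewrite DE; apply: cvg_trans ql|apply: cvg_trans qh];
  apply: near_eq_cvg; near=> h;
  (have h0 : h^-1 < 0 by rewrite invr_lt0);
  (have E : x t = iadd (x (t - h)) (hdiff (x t) (x (t - h)))
    by apply: iadd_hdiff; near: h);
  rewrite invrN mulNr -mulrN opprB.
  by rewrite hi_iscale_neg// [in RHS]E lo_iadd [lo (x _) + _]addrC addrK.
by rewrite lo_iscale_neg// [in RHS]E hi_iadd [hi (x _) + _]addrC addrK.
Unshelve. all: by end_near. Qed.

Lemma translate_ii_derive T t A (c : R -> R) (v : R) : is_derive t 1 c v ->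
  is_ii_derive 0 T (fun s => iadd A (isingle (c s))) t (isingle v).
Proof.
move=> Dc.
have q : h^-1 * (c (t + h) - c t) @[h --> (0 : R)^'] --> v.
  have [/cvg_ex[l cl] cv] := Dc.
  have : h^-1 *: (c (h *: 1 + t) - c t) @[h --> (0 : R)^'] --> v.
    by rewrite -cv /derive; have -> := cvg_lim (@Rhausdorff R) cl; exact: cl.
  by under eq_fun do rewrite [_ *: 1]mulr1 [_ + t]addrC.
have shiftE r s : iadd A (isingle r) = iadd (iadd A (isingle s)) (isingle (r - s)).
  apply: cbitv_ext; rewrite !(lo_iadd, hi_iadd, lo_isingle, hi_isingle);
    by rewrite -addrA [s + _]addrC subrK.
have hdiffE r s : hdiff (iadd A (isingle r)) (iadd A (isingle s)) = isingle (r - s).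
  by rewrite (shiftE r s) hdiff_iadd.
have ql : h^-1 * (c (t + h) - c t) @[h --> (0 : R)^'-] --> v.
  exact: cvg_dnbhs_at_left.
have qr : h^-1 * (c t - c (t - h)) @[h --> (0 : R)^'-] --> v.
  apply/cvg_at_leftNP; rewrite oppr0 /comp.
  under eq_fun do rewrite opprK invrN mulNr -mulrN opprB.
  exact: cvg_dnbhs_at_right.
split=> _; split.
- by apply: nearW => h; eexists; exact: shiftE.
- under eq_fun do rewrite hdiffE iscale_isingle.
  exact: (cvg_comp _ _ ql (isingle_continuous v)).
- by apply: nearW => h; eexists; exact: shiftE.
- under eq_fun do rewrite hdiffE iscale_isingle.
  exact: (cvg_comp _ _ qr (isingle_continuous v)).
Qed.

End ii_derivative.

(** * The control system *)

Section euclidean_norm.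
Context {R : realType} {n : nat}.
Implicit Types v : 'rV[R]_n.

Lemma enorm0 : enorm (0 : 'rV[R]_n) = 0.
Proof.
rewrite /enorm big1 ?sqrtr0// => i _.
by rewrite mxE expr0n.
Qed.

Lemma norm_le_enorm v : `|v| <= enorm v.
Proof.
rewrite [`|v|]mx_normrE; apply: bigmax_le; first exact: sqrtr_ge0.
move=> [i j] _ /=; rewrite (ord1 i) -sqrtr_sqr /enorm ler_sqrt.
  rewrite (bigD1 j)//= lerDl; apply: sumr_ge0 => k _; exact: sqr_ge0.
by apply: sumr_ge0 => k _; exact: sqr_ge0.
Qed.

Lemma enorm_le_norm v : enorm v <= Num.sqrt n%:R * `|v|.
Proof.
rewrite -[`|v|]ger0_norm// -sqrtr_sqr -sqrtrM ?ler0n// /enorm ler_sqrt; last first.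
  by rewrite mulr_ge0 ?sqr_ge0.
have -> : n%:R * `|v| ^+ 2 = \sum_(i < n) `|v| ^+ 2.
  by rewrite sumr_const card_ord mulr_natl.
apply: ler_sum => i _; rewrite -[leLHS]real_normK ?num_real//.
rewrite lerXn2r ?nnegrE//.
rewrite [`|v|]mx_normrE.
exact: (le_bigmax _ (fun ij : 'I_1 * 'I_n => `|v ij.1 ij.2|) (0, i)).
Qed.

Lemma sup_dist_le_Unorm (T : R) (u v : R -> 'rV[R]_n) : 0 < T ->
  Uad T u -> Uad T v -> sup_dist `[0, T] v u <= Unorm T (u \- v).
Proof.
move=> T0 cu cv.
have T_neq0 : `[0, T] !=set0 by exists 0; rewrite /= in_itv /= lexx ltW.
apply: sup_dist_le => // t tT; rewrite distrC.
apply: le_trans (norm_le_enorm _) _; apply: ub_le_sup; last by exists t.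
exists (Num.sqrt n%:R * sup_dist `[0, T] u v) => _ [s sT <-].
apply: le_trans (enorm_le_norm _) _; apply: ler_wpM2l; first exact: sqrtr_ge0.
exact: (le_sup_dist _ (@segment_compact R 0 T)).
Qed.

End euclidean_norm.

(** If the point [0,0] is the sum of the integral of -f and an interval, then
    the integral has no width. For the constant control [e] and the constant function
    [z], this says that the width of [f (s, z, e)], which is nonnegative and
    continuous in [s], has integral 0. *)
Lemma hukuhara_singleton (R : realType) (n : nat) (T : R)
    (f : R * cbitv R * 'rV[R]_n -> cbitv R) : 0 < T ->
  {within dom T, continuous f} ->
  (forall (u : R -> 'rV[R]_n) (t : R), Uad T u -> t \in `[0, T] ->
     forall y : R -> cbitv R, {within `[0, T], continuous y} ->
     forall chi : cbitv R,
       hdiff_exists chi (aumann 0 t (fun s => iopp (f (s, y s, u s))))) ->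
  forall t, t \in `[0, T] -> forall z e, lo (f (t, z, e)) = hi (f (t, z, e)).
Proof.
move=> T_gt0 f_cont hukuhara t tT z e.
have TT : T \in `[0, T] by rewrite in_itv /= lexx ltW.
pose g s := f (s, z, e).
have cg : {within `[0, T], continuous g}.
  apply: (within_continuous_comp `[0, T] (dom T) f (fun s => (s, z, e)) f_cont) => //.
  apply: continuous_subspaceT => s.
  have cs : r @[r --> s] --> s by exact: cvg_id.
  have cz : z @[_ --> s] --> z by exact: cvg_cst.
  have ce : e @[_ --> s] --> e by exact: cvg_cst.
  exact: (cvg_pair (cvg_pair cs cz) ce).
have clo : {within `[0, T], continuous (lo \o g)}.
  by move=> s; exact: (cvg_comp _ _ (cg s) (lo_continuous _)).
have chi : {within `[0, T], continuous (hi \o g)}.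
  by move=> s; exact: (cvg_comp _ _ (cg s) (hi_continuous _)).
have N1 : -1 < 0 :> R by rewrite ltrN10.
have lo_opp A : lo (iopp A) = - hi A by rewrite /iopp lo_iscale_neg// mulN1r.
have hi_opp A : hi (iopp A) = - lo A by rewrite /iopp hi_iscale_neg// mulN1r.
pose h s := iopp (g s).
have clo' : {within `[0, T], continuous (lo \o h)}.
  rewrite (_ : lo \o h = fun s => - hi (g s)); last first.
    by apply/funext => s; exact: lo_opp.
  by move=> s; exact: (continuousN (chi s)).
have chi' : {within `[0, T], continuous (hi \o h)}.
  rewrite (_ : hi \o h = fun s => - lo (g s)); last first.
    by apply/funext => s; exact: hi_opp.
  by move=> s; exact: (continuousN (clo s)).
have ilo := within_continuous_integrable _ _ _ (ltW T_gt0) clo'.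
have ihi := within_continuous_integrable _ _ _ (ltW T_gt0) chi'.
have [loA hiA] := aumann_ends _ _ _ ilo ihi.
have [C CE] : hdiff_exists (isingle 0) (aumann 0 T h).
  apply: (hukuhara (fun=> e) T _ TT (fun=> z)).
    by apply: continuous_subspaceT => s; exact: cst_continuous.
  by apply: continuous_subspaceT => s; exact: cst_continuous.
pose w s := hi (h s) - lo (h s).
have cw : {within `[0, T], continuous w}.
  by move=> s; exact: (continuousB (chi' s) (clo' s)).
have w_ge0 s : s \in `[0, T] -> 0 <= w s.
  by move=> _; rewrite subr_ge0; exact: ends_le.
have w_int : \int[@completed_lebesgue_measure R]_(s in `[0, T]) w s <= 0.
  rewrite RintegralB//; last exact: lebesgue_measurable_itv.
  rewrite -loA -hiA.
  have loE := congr1 lo CE; have hiE := congr1 hi CE.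
  have := ends_le C; rewrite -/(lo C) -/(hi C).
  by move: loE hiE; rewrite lo_iadd hi_iadd lo_isingle hi_isingle; lra.
have := continuous_integral0 _ _ _ T_gt0 cw w_ge0 w_int t tT.
by rewrite /w hi_opp lo_opp -/(g t); lra.
Qed.

Section control_system.
Context {R : realType} {n : nat}.
Variables (T : R) (f : R * cbitv R * 'rV[R]_n -> cbitv R) (x0 : cbitv R).
Variables (k1 k2 : R).
Hypotheses (T_gt0 : 0 < T) (k1_gt0 : 0 < k1) (k2_gt0 : 0 < k2).
Hypothesis f_cont : {within dom T, continuous f}.
Hypothesis f_lipschitz : forall t, t \in `[0, T] ->
  forall (x1 x2 : cbitv R) (u1 u2 : 'rV[R]_n),
    dH (f (t, x1, u1)) (f (t, x2, u2)) <= k1 * dH x1 x2 + k2 * enorm (u1 - u2).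
Hypothesis f_singleton : forall t, t \in `[0, T] -> forall z e,
  lo (f (t, z, e)) = hi (f (t, z, e)).
Implicit Types (u : R -> 'rV[R]_n) (x : R -> cbitv R) (t : R).

Lemma f_isingle t z e : t \in `[0, T] -> f (t, z, e) = isingle (lo (f (t, z, e))).
Proof. by move=> tT; apply: cbitv_ext => //; rewrite hi_isingle -f_singleton. Qed.

(** The translation by [c] is an isometric embedding of R in the intervals, which
    carries the scalar equation for [c] to the control system. *)
Lemma solution_exists u : Uad T u -> exists x, is_solution T f x0 u x.
Proof.
move=> cu.
pose place (p : R * R) := (clamp T p.1, iadd x0 (isingle p.2), u (clamp T p.1)).
pose phi t c := lo (f (place (t, c))).
have clampT t : clamp T t \in `[0, T] by apply: clamp_itv; exact: ltW.
have cucl : continuous (u \o clamp T).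
  apply/continuous_subspace_setT.
  apply: (within_continuous_comp setT _ u (clamp T) cu).
    exact: (continuous_subspaceT (clamp_continuous T)).
  by move=> t _; exact: clampT.
have cplace : continuous place.
  move=> p.
  have pf : q.1 @[q --> p] --> p.1 by exact: (@cvg_fst _ _ (nbhs p.1) (nbhs p.2) _).
  have ps : q.2 @[q --> p] --> p.2 by exact: (@cvg_snd _ _ (nbhs p.1) (nbhs p.2) _).
  have c1 : clamp T q.1 @[q --> p] --> clamp T p.1.
    exact: (cvg_comp _ _ pf (clamp_continuous T p.1)).
  have c2 : iadd x0 (isingle q.2) @[q --> p] --> iadd x0 (isingle p.2).
    exact: (cvg_comp _ _ ps (translate_continuous x0 p.2)).
  have c3 : u (clamp T q.1) @[q --> p] --> u (clamp T p.1).
    exact: (cvg_comp _ _ pf (cucl p.1)).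
  exact: (cvg_pair (cvg_pair c1 c2) c3).
have cphi : continuous (fun p : R * R => phi p.1 p.2).
  have cfp : continuous (f \o place).
    apply/continuous_subspace_setT.
    apply: (within_continuous_comp setT _ f place f_cont).
      exact: (continuous_subspaceT cplace).
    by move=> p _; exact: clampT.
  have -> : (fun p : R * R => phi p.1 p.2) = lo \o (f \o place).
    by apply/funext => -[].
  move=> p; exact: (cvg_comp _ _ (cfp p) (lo_continuous _)).
have [c [c0 Dc]] : exists c : R -> R, c 0 = 0 /\
    forall t, t \in `[0, T] -> is_derive t 1 c (phi t (c t)).
  apply: (picard_lindelof T k1 phi T_gt0 k1_gt0 cphi) => t c1 c2 tT.
  apply: le_trans (lo_dist _ _) _; apply: le_trans (f_lipschitz _ (clampT t) _ _ _ _) _.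
  by rewrite subrr enorm0 mulr0 addr0 dH_translate.
exists (fun t => iadd x0 (isingle (c t))); split.
  rewrite c0; apply: cbitv_ext;
    by rewrite ?lo_iadd ?hi_iadd ?lo_isingle ?hi_isingle addr0.
move=> t tT; rewrite (f_isingle _ _ _ tT).
have := translate_ii_derive T t x0 c _ (Dc t tT).
by rewrite /phi /place /= clamp_id.
Qed.

(** Both endpoints of a trajectory have the same derivative, so its width is
    constant. *)
Lemma solution_ends u x : is_solution T f x0 u x ->
  [/\ {within `[0, T], continuous (lo \o x)},
      forall t, t \in `]0, T[ -> is_derive t 1 (lo \o x) (lo (f (t, x t, u t))) &
      forall t, t \in `[0, T] -> hi (x t) - lo (x t) = hi x0 - lo x0].
Proof.
move=> [x_init Dx].
have D t : t \in `[0, T] -> _ := fun tT =>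
  ii_derive_ends T t x _ (f_singleton t tT (x t) (u t)) (Dx t tT).
have [clo Dlo] : {within `[0, T], continuous (lo \o x)} /\
    forall t, t \in `]0, T[ -> is_derive t 1 (lo \o x) (lo (f (t, x t, u t))).
  apply: (one_sided_derive _ _ (fun t => lo (f (t, x t, u t))) T_gt0) => t tT lt.
    by have [/(_ lt)[]] := D t tT.
  by have [_ /(_ lt)[]] := D t tT.
have [chi Dhi] : {within `[0, T], continuous (hi \o x)} /\
    forall t, t \in `]0, T[ -> is_derive t 1 (hi \o x) (lo (f (t, x t, u t))).
  apply: (one_sided_derive _ _ (fun t => lo (f (t, x t, u t))) T_gt0) => t tT lt.
    by have [/(_ lt)[]] := D t tT.
  by have [_ /(_ lt)[]] := D t tT.
split=> // t tT; rewrite -x_init; apply/eqP; rewrite -subr_eq0 -normr_le0.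
pose w s := hi (x s) - lo (x s).
have cw : {within `[0, T], continuous w}.
  by move=> s; exact: (continuousB (chi s) (clo s)).
have Dw s : s \in `]0, T[ -> is_derive s 1 w 0.
  move=> sT; rewrite -(subrr (lo (f (s, x s, u s)))).
  by exact: (is_deriveB (Dhi s sT) (Dlo s sT)).
have c0 : {within `[0, T], continuous (fun=> 0 : R)}.
  by apply: continuous_subspaceT => s; exact: cst_continuous.
have := derive_bound T w (fun=> 0) (fun=> 0) (fun=> 0) cw c0 Dw
  (fun s _ => is_derive_cst _ _ _) _ t tT.
by rewrite subrr; apply => s _; rewrite normr0.
Qed.

(** Since all trajectories have the width of [x0], the Hausdorff distance of two of
    them is the distance of their lower endpoints, to which [gronwall] applies. *)
Lemma solution_stability u1 u2 x1 x2 (delta : R) :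
  is_solution T f x0 u1 x1 -> is_solution T f x0 u2 x2 ->
  (forall t, t \in `[0, T] -> enorm (u1 t - u2 t) <= delta) ->
  forall t, t \in `[0, T] -> dH (x1 t) (x2 t) ^+ 2 <=
    (k2 * delta) ^+ 2 * T * expR ((2 * k1 + 1) * T).
Proof.
move=> sol1 sol2 u12.
have [c1 D1 w1] := solution_ends _ _ sol1.
have [c2 D2 w2] := solution_ends _ _ sol2.
have dHE t : t \in `[0, T] -> dH (x1 t) (x2 t) = `|lo (x1 t) - lo (x2 t)|.
  move=> tT; rewrite /dH.
  have -> : hi (x1 t) - hi (x2 t) = lo (x1 t) - lo (x2 t).
    by have := w1 t tT; have := w2 t tT; lra.
  exact: maxxx.
pose w s := lo (x1 s) - lo (x2 s).
have cw : {within `[0, T], continuous w}.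
  by move=> s; exact: (continuousB (c1 s) (c2 s)).
have O : 0 \in `[0, T] by rewrite in_itv /= lexx ltW.
have delta0 : 0 <= delta by apply: le_trans (u12 0 O); exact: sqrtr_ge0.
move=> t tT; rewrite dHE// real_normK ?num_real//.
apply: (gronwall T k1 (k2 * delta) w
  (fun s => lo (f (s, x1 s, u1 s)) - lo (f (s, x2 s, u2 s)))) => //.
- exact: ltW.
- by rewrite mulr_ge0// ltW.
- by rewrite /w (proj1 sol1) (proj1 sol2) subrr.
- by move=> s sT; exact: (is_deriveB (D1 s sT) (D2 s sT)).
- move=> s /subset_itv_oo_cc sT; apply: le_trans (lo_dist _ _) _.
  apply: le_trans (f_lipschitz _ sT _ _ _ _) _.
  by rewrite dHE// lerD2l ler_wpM2l ?(ltW k2_gt0)// u12.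
Qed.

Lemma solution_cvg (u : nat -> R -> 'rV[R]_n) v (x : nat -> R -> cbitv R) y :
  (forall k, Uad T (u k)) -> Uad T v ->
  (forall k, is_solution T f x0 (u k) (x k)) -> is_solution T f x0 v y ->
  sup_dist `[0, T] (u k) v @[k --> \oo] --> (0 : R) ->
  forall t, t \in `[0, T] -> x k t @[k --> \oo] --> y t.
Proof.
move=> cu cv solu solv uv t tT; apply: cvg_cbitv.
pose C := k2 * Num.sqrt n%:R * Num.sqrt (T * expR ((2 * k1 + 1) * T)).
have C0 : C * sup_dist `[0, T] (u k) v @[k --> \oo] --> (0 : R).
  have : C * sup_dist `[0, T] (u k) v @[k --> \oo] --> C * 0 by exact: cvgMr.
  by rewrite mulr0.
apply: (@squeeze_cvgr _ _ _ _ (fun=> 0)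
  (fun k => C * sup_dist `[0, T] (u k) v)) => //; last exact: cvg_cst.
apply: nearW => k; rewrite dHC; apply/andP; split.
  by rewrite /dH le_max normr_ge0.
have T0 : 0 <= T * expR ((2 * k1 + 1) * T) by rewrite mulr_ge0 ?expR_ge0 ?ltW.
have d0 : 0 <= sup_dist `[0, T] (u k) v.
  apply: le_trans (le_sup_dist _ (@segment_compact R 0 T) _ _ _ (cu k) cv tT).
  exact: normr_ge0.
have C_ge0 : 0 <= C * sup_dist `[0, T] (u k) v.
  by rewrite /C !mulr_ge0 ?sqrtr_ge0 ?(ltW k2_gt0).
rewrite -(ler_pXn2r (ltn0Sn 1)) ?nnegrE//; last by rewrite /dH le_max normr_ge0.
have := solution_stability _ _ _ _ (Num.sqrt n%:R * sup_dist `[0, T] (u k) v)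
  (solu k) solv _ t tT.
rewrite (_ : (C * _) ^+ 2 = (k2 * (Num.sqrt n%:R * sup_dist `[0, T] (u k) v)) ^+ 2
  * T * expR ((2 * k1 + 1) * T)); last first.
  by rewrite /C !exprMn [Num.sqrt (T * _) ^+ 2]sqr_sqrtr//; ring.
apply => s sT; apply: le_trans (enorm_le_norm _) _.
apply: ler_wpM2l; first exact: sqrtr_ge0.
exact: (le_sup_dist _ (@segment_compact R 0 T) _ _ _ (cu k) cv sT).
Qed.

End control_system.

(** * Lower semicontinuity of the cost *)

Section lower_semicontinuity.
Context {R : realType}.

Lemma le_limn_einf (u : nat -> \bar R) (b : \bar R) :
  (\forall k \near \oo, (b <= u k)%E) -> (b <= limn_einf u)%E.
Proof.
move=> [N _ bu]; rewrite limn_einf_lim; apply: lime_ge; first exact: is_cvg_einfs.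
exists N => // k /= Nk; apply: le_ereal_inf_tmp => _ [m /= km <-].
exact/bu/(leq_trans Nk).
Qed.

Lemma limn_einf_le (u : nat -> \bar R) (b : \bar R) :
  (\forall k \near \oo, (u k <= b)%E) -> (limn_einf u <= b)%E.
Proof.
move=> ub; rewrite limn_einf_lim; apply: lime_le; first exact: is_cvg_einfs.
apply: filterS ub => k ukb; apply: le_trans ukb.
by apply: ereal_inf_lbound; exists k => /=.
Qed.

(** The sublevel set [hi (g y) <= b] is the set of [y] with [ile (g y) (isingle b)],
    because the lower endpoint never exceeds the upper one. *)
Lemma ile_lsc_hi (Y : topologicalType) (D : set Y) (g : Y -> cbitv R)
    (p : nat -> Y) (q : Y) :
  ile_lsc D g -> (forall k, D (p k)) -> D q -> p @ \oo --> q ->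
  ((hi (g q))%:E <= limn_einf (fun k => (hi (g (p k)))%:E))%E.
Proof.
move=> lsc Dp Dq pq; apply/lee_addgt0Pr => r r0.
suff : ((hi (g q) - r)%:E <= limn_einf (fun k => (hi (g (p k)))%:E))%E.
  by rewrite EFinB leeBlDr.
apply: le_limn_einf.
have ileE y : ile (g y) (isingle (hi (g q) - r)) = (hi (g y) <= hi (g q) - r).
  rewrite /ile lo_isingle hi_isingle; apply/andP/idP => [[]//|h]; split=> //.
  exact: le_trans (ends_le (g y)) h.
have /closed_subspaceP[V V_closed VE] := lsc (isingle (hi (g q) - r)).
have nVq : nbhs q (~` V).
  apply: open_nbhs_nbhs; split; first exact: closed_openC.
  move=> Vq; have [_ ] : [set y | D y /\ ile (g y) (isingle (hi (g q) - r))] q.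
    have : (V `&` D) q by [].
    by rewrite VE => -[].
  by rewrite ileE leNgt ltrBlDr ltrDl r0.
have : \forall k \near \oo, ~ V (p k) by exact: pq _ nVq.
apply: filterS => k nVp; rewrite lee_fin leNgt.
apply/negP => lt_hi; apply: nVp.
have : (V `&` D) (p k) by rewrite VE; split=> //; split=> //; rewrite ileE ltW.
by case.
Qed.

End lower_semicontinuity.

Section optimal_control.
Context {R : realType} {n : nat}.
Variables (T : R) (f L : R * cbitv R * 'rV[R]_n -> cbitv R) (x0 : cbitv R).
Variables (k1 k2 : R).
Notation mu := (@completed_lebesgue_measure R).
Notation lebesgueT := (caratheodory_type ((@wlength R idfun)^*)%mu).
Hypotheses (T_gt0 : 0 < T) (k1_gt0 : 0 < k1) (k2_gt0 : 0 < k2).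
Hypothesis f_cont : {within dom T, continuous f}.
Hypothesis f_lipschitz : forall t, t \in `[0, T] ->
  forall (x1 x2 : cbitv R) (u1 u2 : 'rV[R]_n),
    dH (f (t, x1, u1)) (f (t, x2, u2)) <= k1 * dH x1 x2 + k2 * enorm (u1 - u2).
Hypothesis f_singleton : forall t, t \in `[0, T] -> forall z e,
  lo (f (t, z, e)) = hi (f (t, z, e)).
Hypothesis L_int : forall (u : R -> 'rV[R]_n) (x : R -> cbitv R),
  Uad T u -> is_solution T f x0 u x ->
  imeasurable 0 T (fun t => L (t, x t, u t)) /\
  integrably_bounded 0 T (fun t => L (t, x t, u t)).
Hypothesis L_lsc : ile_lsc (dom T) L.
Hypothesis L_ge0 : forall t, t \in `[0, T] ->
  forall (zeta : cbitv R) (eta : 'rV[R]_n), ile (isingle 0) (L (t, zeta, eta)).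
Implicit Types (u : R -> 'rV[R]_n) (t : R).

Notation traj := (trajectory T f x0).
Notation running u := (fun t => L (t, traj u t, u t)).

Lemma trajectory_solution u : Uad T u -> is_solution T f x0 u (traj u).
Proof.
move=> cu; apply: (@getPex _ [set x | is_solution T f x0 u x]).
exact: (solution_exists T f x0 k1 k2).
Qed.

Lemma running_integrable u : Uad T u ->
  mu.-integrable `[0, T] (EFin \o (lo \o running u)) /\
  mu.-integrable `[0, T] (EFin \o (hi \o running u)).
Proof.
move=> cu; have [mL bL] := L_int _ _ cu (trajectory_solution _ cu).
exact: integrably_bounded_integrable.
Qed.

Lemma hi_cost u : Uad T u ->
  (hi (cost T f x0 L u))%:E = (\int[mu]_(t in `[0%R, T]) (hi (running u t))%:E)%E.
Proof.
move=> cu; have [ilo ihi] := running_integrable _ cu.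
rewrite /cost (aumann_ends _ _ _ ilo ihi).2 fineK//.
by apply: integrable_fin_num ihi; exact: lebesgue_measurable_itv.
Qed.

Lemma running_ge0 u t : t \in `[0, T] -> 0 <= hi (running u t).
Proof. by move=> tT; have /andP[_] := L_ge0 _ tT (traj u t) (u t). Qed.

Lemma hi_cost_ge0 u : Uad T u -> 0 <= hi (cost T f x0 L u).
Proof.
move=> cu; rewrite -lee_fin hi_cost//; apply: integral_ge0 => t tT.
by rewrite lee_fin running_ge0.
Qed.

(** Fatou's lemma, along the trajectories of [u k], which converge pointwise to
    that of [v]. *)
Lemma hi_cost_lsc (u : nat -> R -> 'rV[R]_n) v a :
  (forall k, Uad T (u k)) -> Uad T v ->
  sup_dist `[0, T] (u k) v @[k --> \oo] --> (0 : R) ->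
  (\forall k \near \oo, hi (cost T f x0 L (u k)) <= a) ->
  hi (cost T f x0 L v) <= a.
Proof.
move=> cu cv uv cost_le; rewrite -lee_fin hi_cost//.
have mD := lebesgue_measurable_itv `[0, T].
pose F k (t : lebesgueT) := (hi (running (u k) t))%:E.
have mF k : measurable_fun (`[0, T] : set lebesgueT) (F k).
  exact: measurable_int (running_integrable _ (cu k)).2.
have F_ge0 k t : t \in `[0, T] -> (0 <= F k t)%E.
  by move=> tT; rewrite lee_fin running_ge0.
have mliminf : measurable_fun (`[0, T] : set lebesgueT)
    (fun t => limn_einf (F ^~ t)).
  apply: emeasurable_fun_cvg (measurable_fun_einfs mF) _ => t _.
  by rewrite limn_einf_lim; exact: is_cvg_einfs.
have pointwise t : t \in `[0, T] ->
    ((hi (running v t))%:E <= limn_einf (F ^~ t))%E.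
  move=> tT.
  have xt : traj (u k) t @[k --> \oo] --> traj v t.
    apply: (solution_cvg T f x0 k1 k2 T_gt0 k1_gt0 k2_gt0 f_lipschitz f_singleton
      u v (fun k => traj (u k)) (traj v) cu cv _ _ uv t tT).
      by move=> k; exact: trajectory_solution.
    exact: trajectory_solution.
  have ut : u k t @[k --> \oo] --> v t.
    apply/cvgrPdist_le => e e0; near=> k; rewrite distrC.
    apply: le_trans (le_sup_dist _ (@segment_compact R 0 T) _ _ _ (cu k) cv tT) _.
    by near: k; exact: (cvgr_le _ uv _ e0).
  have tt : t @[k --> \oo] --> t by exact: cvg_cst.
  apply: (ile_lsc_hi _ _ _ (fun k => (t, traj (u k) t, u k t)) _ L_lsc) => //.
  exact: (cvg_pair (cvg_pair tt xt) ut).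
have limit_ge0 t : t \in `[0, T] -> (0 <= (EFin \o (hi \o running v)) t)%E.
  by move=> tT; have := running_ge0 v t tT; rewrite -lee_fin.
apply: le_trans (ge0_le_integral mu mD limit_ge0
  (measurable_int _ (running_integrable _ cv).2) mliminf pointwise) _.
apply: le_trans (fatou mu mD mF F_ge0) _.
apply: limn_einf_le; apply: filterS cost_le => k.
by rewrite -lee_fin hi_cost.
Unshelve. all: by end_near. Qed.

(** [Uad T] is complete for the uniform distance on [0, T], although its elements
    are functions on R with arbitrary values outside [0, T]. *)
Lemma ekeland_cost (eps : R) : 0 < eps ->
  exists2 u0, Uad T u0 & forall u, Uad T u ->
    hi (cost T f x0 L u0) <= hi (cost T f x0 L u) + eps * sup_dist `[0, T] u0 u.
Proof.
move=> eps_gt0.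
have T_cpt : compact (`[0, T] : set R) by exact: segment_compact.
have T_neq0 : (`[0, T] : set R) !=set0.
  by exists 0; rewrite /= in_itv /= lexx ltW.
apply: (ekeland R _ (Uad T) (sup_dist `[0, T]) (fun u => hi (cost T f x0 L u))).
- exact: eps_gt0.
- exists (fun=> 0); rewrite /Uad /=; apply: continuous_subspaceT => t.
  exact: cst_continuous.
- by move=> u _; exact: sup_distxx.
- move=> u v cu cv; have [t tT] := T_neq0.
  apply: le_trans (le_sup_dist _ T_cpt _ _ _ cu cv tT); exact: normr_ge0.
- by move=> u v _ _; exact: sup_distC.
- by move=> u v w cu cv cw; exact: sup_dist_triangle.
- move=> u e cu e0 u_cauchy.
  have [v cv uv] : exists2 v : R -> 'rV[R]_n, Uad T v &
      forall k t, t \in `[0, T] -> `|u k t - v t| <= e k.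
    apply: (uniform_cauchy_limit _ _ _ _ _ e cu e0) => k m t km tT.
    exact: le_trans (le_sup_dist _ T_cpt _ _ _ (cu k) (cu m) tT) (u_cauchy k m km).
  exists v => //; apply: (@squeeze_cvgr _ _ _ _ (fun=> 0) e) => //; last exact: cvg_cst.
  apply: nearW => k; apply/andP; split; last by apply: sup_dist_le => // t; exact: uv.
  have [t tT] := T_neq0.
  apply: le_trans (le_sup_dist _ T_cpt _ _ _ (cu k) cv tT); exact: normr_ge0.
- exact: hi_cost_ge0.
- exact: hi_cost_lsc.
Qed.

End optimal_control.

(** * Existence of an eps-minimal solution *)

Theorem theorem4p9 (R : realType) (n : nat) (T : R)
    (f : R * cbitv R * 'rV[R]_n -> cbitv R) (x0 : cbitv R)
    (L : R * cbitv R * 'rV[R]_n -> cbitv R)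
    (T_gt0 : 0 < T)
    (f_cont : {within dom T, continuous f})
    (L_int : forall (u : R -> 'rV[R]_n) (x : R -> cbitv R),
       Uad T u -> is_solution T f x0 u x ->
       imeasurable 0 T (fun t => L (t, x t, u t)) /\
       integrably_bounded 0 T (fun t => L (t, x t, u t)))
    (A2 : exists k1 k2 : R, [/\ 0 < k1, 0 < k2 &
       forall t, t \in `[0, T] ->
       forall (x1 x2 : cbitv R) (u1 u2 : 'rV[R]_n),
         dH (f (t, x1, u1)) (f (t, x2, u2)) <=
           k1 * dH x1 x2 + k2 * enorm (u1 - u2)])
    (A3 : ile_lsc (dom T) L)
    (A4 : forall t, t \in `[0, T] ->
       forall (zeta : cbitv R) (eta : 'rV[R]_n),
         ile (isingle 0) (L (t, zeta, eta)))
    (hukuhara : forall (u : R -> 'rV[R]_n) (t : R),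
       Uad T u -> t \in `[0, T] ->
       forall y : R -> cbitv R, {within `[0, T], continuous y} ->
       forall chi : cbitv R,
         hdiff_exists chi (aumann 0 t (fun s => iopp (f (s, y s, u s)))))
    (eps : R) (eps_gt0 : 0 < eps) :
  exists2 u0 : R -> 'rV[R]_n, Uad T u0 &
    forall u : R -> 'rV[R]_n, Uad T u ->
      ~~ ilt (iadd (cost T f x0 L u) (isingle (eps * Unorm T (u \- u0))))
             (cost T f x0 L u0).
Proof.
have f_singleton := hukuhara_singleton R n T f T_gt0 f_cont hukuhara.
have [k1 [k2 [k1_gt0 k2_gt0 f_lip]]] := A2.
have [u0 cu0 u0_min] := ekeland_cost T f L x0 k1 k2 T_gt0 k1_gt0 k2_gt0 f_cont
  f_lip f_singleton L_int A3 A4 eps eps_gt0.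
exists u0 => // u cu; apply/negP => /andP[_]; rewrite hi_iadd hi_isingle.
apply/negP; rewrite -leNgt; apply: le_trans (u0_min u cu) _.
by rewrite lerD2l ler_wpM2l ?(ltW eps_gt0)//; exact: sup_dist_le_Unorm.
Qed.
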